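(* Let $G$ be a red-blue colouring of $K_n$, let $u \in V(G)$, and let $H = G \setminus \{u\}$. If $H \in \mathcal{C}$, then either $\mathrm{pack}(G) > n(n-1)/4$ or $G \in \mathcal{C}$.
   Context: A red-blue colouring $G$ of $K_n$ assigns red or blue to each edge of the complete graph on the $n$-vertex set $V(G)$; $G_R, G_B$ are the spanning subgraphs of red and blue edges, and $G\setminus\{u\}$ is the colouring induced on $V(G)\setminus\{u\}$. For a graph $F$, a fractional triangle packing is a function $\omega$ from the triangles of $F$ to $[0,1]$ with $\sum_{T \ni e}\omega(T) \le 1$ for every edge $e$; $\nu^*(F)$ is the maximum of $\sum_T\omega(T)$; $\mathrm{pack}(G) = 3(\nu^*(G_R)+\nu^*(G_B))$. $G$ is a pentagon blow-up with blobs $A_1,\dots,A_5$ if $\{A_1,\dots,A_5\}$ is a partition of $V(G)$ into non-empty sets such that all edges between $A_i$ and $A_{i+1}$ are red and all edges between $A_i$ and $A_{i+2}$ are blue for $i \in [5]$ (indices modulo 5; edges inside a blob are coloured arbitrarily); its blob sizes are $|A_1|,\dots,|A_5|$. $G$ is one edge-flip away from a pentagon blow-up with given blob sizes if changing the colour of a single edge of $G$ yields a pentagon blow-up with those blob sizes. Let $\mathcal{B}_1 = \{(3,3,3,4,4), (2,3,4,4,4), (3,3,3,3,5), (3,3,4,4,4), (2,4,4,4,4), (3,3,3,4,5), (3,4,4,4,4), (3,3,4,4,5), (4,4,4,4,4), (3,4,4,4,5), (4,4,4,4,5), (3,4,4,5,5), (4,4,4,5,5), (4,4,5,5,5), (4,5,5,5,5),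 (5,5,5,5,5)\}$ and $\mathcal{B}_2 = \{(3,3,3,4,4), (3,3,4,4,4), (3,4,4,4,4), (4,4,4,4,4), (4,4,4,4,5)\}$. Let $\mathcal{C}_1$ be the family of pentagon blow-ups whose blob sizes, in some order, form a tuple in $\mathcal{B}_1$; let $\mathcal{C}_2$ be the family of red-blue colourings of complete graphs that are one edge-flip away from a pentagon blow-up whose blob sizes, in some order, form a tuple in $\mathcal{B}_2$; and $\mathcal{C} = \mathcal{C}_1 \cup \mathcal{C}_2$. *)

(* Defs.v *)
From mathcomp Require Import all_boot all_order all_algebra.
Set Implicit Arguments. Unset Strict Implicit. Unset Printing Implicit Defensive.
Import Order.TTheory GRing.Theory Num.Theory.
Local Open Scope ring_scope.

(* A red-blue colouring of the complete graph on a vertex set V : {set T}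
   is given by a symmetric relation red : rel T (only its values on pairs
   of distinct vertices of V matter): the edge xy is red iff red x y,
   and blue otherwise. *)

Section Defs.
Variable T : finType.

Definition is_triangle (V : {set T}) (adj : rel T) (S : {set T}) : bool :=
  [&& S \subset V, #|S| == 3%N &
      [forall x in S, forall y in S, (x != y) ==> adj x y]].

(* fractional triangle packing: weights in [0,1] on triangles,
   total weight on triangles through each edge at most 1
   (values of w on non-triangles are irrelevant). *)
Definition frac_tri_packing (V : {set T}) (adj : rel T) (w : {set T} -> rat) : Prop :=
  (forall S, is_triangle V adj S -> 0 <= w S <= 1) /\
  (forall x y, x \in V -> y \in V -> x != y -> adj x y ->
     \sum_(S : {set T} | [&& is_triangle V adj S, x \in S & y \in S]) w S <= 1).

Definition tri_weight (V : {set T}) (adj : rel T) (w : {set T} -> rat) : rat :=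
  \sum_(S : {set T} | is_triangle V adj S) w S.

Definition blue_rel (red : rel T) : rel T := fun x y => ~~ red x y.

(* pack(G) > b, with pack(G) = 3 (nu*(G_R) + nu*(G_B)) *)
Definition pack_gt (V : {set T}) (red : rel T) (b : rat) : Prop :=
  exists wR wB : {set T} -> rat,
    [/\ frac_tri_packing V red wR, frac_tri_packing V (blue_rel red) wB &
        b < 3%:R * (tri_weight V red wR + tri_weight V (blue_rel red) wB)].

(* Pentagon blow-up: f assigns each vertex its blob A_i = f^-1(i) (i mod 5). *)
Definition pentagon_blowup (V : {set T}) (red : rel T) (f : T -> 'I_5) : Prop :=
  (forall i : 'I_5, [exists x in V, f x == i]) /\
  (forall x y, x \in V -> y \in V ->
     ((val (f y) == (val (f x) + 1) %% 5)%N -> red x y) /\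
     ((val (f y) == (val (f x) + 2) %% 5)%N -> ~~ red x y)).

Definition blob_sizes (V : {set T}) (f : T -> 'I_5) : seq nat :=
  [seq #|[set x in V | f x == i]| | i <- enum 'I_5].

Definition flip (red : rel T) (x y : T) : rel T :=
  fun a b => if ((a == x) && (b == y)) || ((a == y) && (b == x))
             then ~~ red a b else red a b.

End Defs.

Definition B1 : seq (seq nat) :=
  [:: [:: 3; 3; 3; 4; 4]; [:: 2; 3; 4; 4; 4]; [:: 3; 3; 3; 3; 5];
      [:: 3; 3; 4; 4; 4]; [:: 2; 4; 4; 4; 4]; [:: 3; 3; 3; 4; 5];
      [:: 3; 4; 4; 4; 4]; [:: 3; 3; 4; 4; 5]; [:: 4; 4; 4; 4; 4];
      [:: 3; 4; 4; 4; 5]; [:: 4; 4; 4; 4; 5]; [:: 3; 4; 4; 5; 5];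
      [:: 4; 4; 4; 5; 5]; [:: 4; 4; 5; 5; 5]; [:: 4; 5; 5; 5; 5];
      [:: 5; 5; 5; 5; 5]]%N.

Definition B2 : seq (seq nat) :=
  [:: [:: 3; 3; 3; 4; 4]; [:: 3; 3; 4; 4; 4]; [:: 3; 4; 4; 4; 4];
      [:: 4; 4; 4; 4; 4]; [:: 4; 4; 4; 4; 5]]%N.

Definition in_C1 (T : finType) (V : {set T}) (red : rel T) : Prop :=
  exists f : T -> 'I_5, pentagon_blowup V red f /\
    exists2 t, t \in B1 & perm_eq (blob_sizes V f) t.

Definition in_C2 (T : finType) (V : {set T}) (red : rel T) : Prop :=
  exists x y : T, [/\ x \in V, y \in V, x != y &
    exists f : T -> 'I_5, pentagon_blowup V (flip red x y) f /\
      exists2 t, t \in B2 & perm_eq (blob_sizes V f) t].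

Definition in_C (T : finType) (V : {set T}) (red : rel T) : Prop :=
  in_C1 V red \/ in_C2 V red.

(* Main.v *)
(* Let A_1, ..., A_5 be the blobs of H, of sizes a_i, and for each colour consider
   the cyclic order of the blobs in which consecutive blobs are joined in that
   colour.  An edge inside A_i can be fully covered by the triangles of its colour
   whose apex lies in the two blobs next to A_i, and the triangles u v w with v, w
   in consecutive blobs and all edges of one colour come for free, since they use
   no edge inside a blob.  Hence
     pack(G) >= 3 (sum_i C(a_i, 2) + M),
   where M is the largest weight of free triangles (a fractional matching between
   the neighbourhoods of u) that fits into the capacity left on the edges between
   blobs.  If H is one flip of an edge xy away from a blow-up, take such a packing
   of the blow-up that puts little weight on xy, drop the triangles through xy,
   and use xy in its new colour with the one blob joined to both x and y in that
   colour.

   For the finitely many sizes in question, a verified search shows that this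
   exceeds n(n-1)/4 unless u is joined to the blobs as a vertex of some blob would
   be, with at most one exception, and then G is in the family C. *)

From Stdlib Require Import NArith.
Require Import Defs.
From mathcomp Require Import all_boot all_order all_algebra.
From mathcomp Require Import ring lra zify.
Set Implicit Arguments. Unset Strict Implicit. Unset Printing Implicit Defensive.
Import Order.TTheory GRing.Theory Num.Theory.
Local Open Scope ring_scope.

(** * Packings from weights on ordered triples *)

Section TriangleFlows.
Variable T : finType.
Implicit Types (e : rel T) (g : T -> T -> T -> rat) (a b x y z : T).

(* A triangle gets the sum of the weights [g] gives to its six orderings. *)
Definition tri_flow e g : Prop :=
  (forall x y z, 0 <= g x y z) /\
  (forall x y z, g x y z != 0 ->
     [/\ x != y, x != z & y != z] /\ [/\ e x y, e x z & e y z]).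

Definition load g a b : rat :=
  \sum_z (g a b z + g b a z + (g a z b + g b z a) + (g z a b + g z b a)).

Definition flow_value g : rat := \sum_x \sum_y \sum_z g x y z.

Lemma loadC g a b : load g a b = load g b a.
Proof. by apply: eq_bigr => z _; ring. Qed.

Lemma loadD g h a b :
  load (fun x y z => g x y z + h x y z) a b = load g a b + load h a b.
Proof. by rewrite -big_split; apply: eq_bigr => z _ /=; ring. Qed.

Lemma ler_load g h a b :
  (forall x y z, g x y z <= h x y z) -> load g a b <= load h a b.
Proof. by move=> le_gh; apply: ler_sum => z _; rewrite !lerD. Qed.

Lemma flow_valueD g h :
  flow_value (fun x y z => g x y z + h x y z) = flow_value g + flow_value h.
Proof.
rewrite -big_split; apply: eq_bigr => x _ /=; rewrite -big_split.
by apply: eq_bigr => y _ /=; rewrite -big_split.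
Qed.

Lemma sum_triples (F : T -> T -> T -> rat) :
  \sum_x \sum_y \sum_z F x y z = \sum_(p : T * T * T) F p.1.1 p.1.2 p.2.
Proof.
rewrite (pair_bigA _ (fun x y => \sum_z F x y z)) /=.
by rewrite (pair_bigA _ (fun p z => F p.1 p.2 z)).
Qed.

Definition triple_set (p : T * T * T) : {set T} := [set p.1.1; p.1.2; p.2].

(** A triple of non-zero weight has distinct entries, so if it contains [a] and [b], they occupy one
    of six ordered pairs of positions, each matched by one term of [load]. *)
Lemma sum_through_le_load e g a b : tri_flow e g -> a != b ->
  \sum_(p | (a \in triple_set p) && (b \in triple_set p)) g p.1.1 p.1.2 p.2
    <= load g a b.
Proof.
move=> [g_ge0 g_tri] neq_ab.
(* One indicator form for each pair of positions turns [load] into a sum over all triples, so that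
   the comparison can be made term by term. *)
pose i x y z (a b : T) := if (x == a) && (y == b) then g x y z else 0.
pose j x y z (a b : T) := if (x == a) && (z == b) then g x y z else 0.
pose k x y z (a b : T) := if (y == a) && (z == b) then g x y z else 0.
have -> : load g a b = \sum_x \sum_y \sum_z
  (i x y z a b + i x y z b a + (j x y z a b + j x y z b a) +
   (k x y z a b + k x y z b a)).
  have iE c d : \sum_x \sum_y \sum_z i x y z c d = \sum_z g c d z.
    rewrite (bigD1 c) //= [X in _ + X]big1 ?addr0; last first.
      by move=> x /negbTE nx; rewrite big1 // => y _; rewrite big1 // => z _; rewrite /i nx.
    rewrite (bigD1 d) //= [X in _ + X]big1 ?addr0; last first.
      by move=> y /negbTE ny; rewrite big1 // => z _; rewrite /i ny andbF.
    by apply: eq_bigr => z _; rewrite /i !eqxx.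
  have jE c d : \sum_x \sum_y \sum_z j x y z c d = \sum_z g c z d.
    rewrite (bigD1 c) //= [X in _ + X]big1 ?addr0; last first.
      by move=> x /negbTE nx; rewrite big1 // => y _; rewrite big1 // => z _; rewrite /j nx.
    apply: eq_bigr => y _; rewrite (bigD1 d) //= [X in _ + X]big1 ?addr0.
      by rewrite /j !eqxx.
    by move=> z /negbTE nz; rewrite /j nz andbF.
  have kE c d : \sum_x \sum_y \sum_z k x y z c d = \sum_z g z c d.
    apply: eq_bigr => x _; rewrite (bigD1 c) //= [X in _ + X]big1 ?addr0; last first.
      by move=> y /negbTE ny; rewrite big1 // => z _; rewrite /k ny.
    rewrite (bigD1 d) //= [X in _ + X]big1 ?addr0.
      by rewrite /k !eqxx.
    by move=> z /negbTE nz; rewrite /k nz andbF.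
  rewrite /load !big_split /= -(iE a b) -(iE b a) -(jE a b) -(jE b a).
  rewrite -(kE a b) -(kE b a) -!big_split; apply: eq_bigr => x _ /=.
  rewrite -!big_split; apply: eq_bigr => y _ /=.
  by rewrite -!big_split.
rewrite sum_triples big_mkcond; apply: ler_sum => -[[x y] z] _ /=.
have h_ge0 (c : bool) : 0 <= if c then g x y z else 0 by case: c.
rewrite /triple_set /= !inE.
have [ge0|] := boolP (g x y z == 0).
  by rewrite (eqP ge0) !if_same /i /j /k (eqP ge0) !if_same !addr0.
move/g_tri => [[nxy nxz nyz] _].
rewrite /i /j /k.
case: ifP => [/andP[]|_]; last by rewrite !addr_ge0.
rewrite [a == x]eq_sym [a == y]eq_sym [a == z]eq_sym [b == x]eq_sym [b == y]eq_sym [b == z]eq_sym.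
have cmp (s1 s2 : rat) : 0 <= s1 -> 0 <= s2 -> g x y z <= g x y z + s1 + s2.
  by move=> ? ?; lra.
have H c := h_ge0 c.
move: (H ((x == a) && (y == b))) (H ((x == b) && (y == a))) (H ((x == a) && (z == b)))
  (H ((x == b) && (z == a))) (H ((y == a) && (z == b))) (H ((y == b) && (z == a))).
have nab: (a == b) = false by apply/negbTE.
move=> H1 H2 H3 H4 H5 H6 /orP[/orP[]|] ea /orP[/orP[]|] eb;
  move: H1 H2 H3 H4 H5 H6; rewrite ?ea ?eb /=;
  do ?[by move: neq_ab; rewrite -(eqP ea) -(eqP eb) eqxx]; lra.
Qed.

Lemma flow_packing e g : symmetric e -> tri_flow e g ->
  (forall a b, a != b -> e a b -> load g a b <= 1) ->
  exists2 w, frac_tri_packing setT e w & tri_weight setT e w = flow_value g.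
Proof.
move=> e_sym g_flow g_load; have [g_ge0 g_tri] := g_flow.
pose w S := \sum_(p | triple_set p == S) g p.1.1 p.1.2 p.2.
have w_ge0 S : 0 <= w S by apply: sumr_ge0.
have tri_set p : g p.1.1 p.1.2 p.2 != 0 -> is_triangle setT e (triple_set p).
  case: p => -[x y] z /= /g_tri [[nxy nxz nyz] [exy exz eyz]].
  rewrite /is_triangle /triple_set /= subsetT /=; apply/andP; split.
    rewrite -setUA cardsU1 cards2 !inE negb_or nxy nxz nyz //.
  apply/forallP => c; apply/implyP; rewrite !inE => /orP[/orP[]|] /eqP ->;
  apply/forallP => d; apply/implyP; rewrite !inE => /orP[/orP[]|] /eqP ->;
  apply/implyP; rewrite ?eqxx //= => _ //; by rewrite e_sym.
have w_load a b : a != b -> e a b ->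
    \sum_(S | [&& is_triangle setT e S, a \in S & b \in S]) w S <= 1.
  move=> nab eab; apply: le_trans (g_load _ _ nab eab).
  apply: le_trans (sum_through_le_load g_flow nab).
  rewrite /w (exchange_big_dep (fun p => (a \in triple_set p) && (b \in triple_set p))) /=; last first.
    by move=> S p /and3P[_ aS bS] /eqP ->; rewrite aS bS.
  apply: ler_sum => p /andP[ap bp].
  have [/eqP ->|/tri_set tp] := boolP (g p.1.1 p.1.2 p.2 == 0); first by rewrite big1.
  rewrite (bigD1 (triple_set p)) ?tp ?ap ?bp ?eqxx //= big1 ?addr0 // => S.
  by move=> /andP[/andP[_ /eqP <-]]; rewrite eqxx.
exists w; last first.
  rewrite /tri_weight /w (exchange_big_dep predT) //= /flow_value sum_triples.
  apply: eq_bigr => p _.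
  have [/eqP ->|/tri_set tp] := boolP (g p.1.1 p.1.2 p.2 == 0); first by rewrite big1.
  rewrite (bigD1 (triple_set p)) ?tp ?eqxx //= big1 ?addr0 // => S.
  by move=> /andP[/andP[_ /eqP <-]]; rewrite eqxx.
split=> [S triS|x y _ _]; last exact: w_load.
rewrite w_ge0 /=.
(* The bound [w S <= 1] comes from any edge of [S], since [w S] is one of the non-negative terms
   bounded there. *)
have [_ /eqP cS /forallP eS] := and3P triS.
have /card_gt1P[a [b [aS bS nab]]] : (1 < #|S|)%N by rewrite cS.
have eab : e a b.
  by move: (eS a); rewrite aS /= => /forallP /(_ b); rewrite bS nab.
apply: le_trans (w_load _ _ nab eab).
by rewrite (bigD1 S) ?triS ?aS ?bS //= lerDl sumr_ge0.
Qed.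

End TriangleFlows.

(** * A packing in one colour *)

Lemma ord5_neq (i : 'I_5) :
  [/\ (i == i + 1) = false, (i == i + 1 + 1) = false & (i + 1 == i) = false].
Proof. by case: i => [[|[|[|[|[|i]]]]] lti]. Qed.

Lemma sum_const_card (T : finType) (P : pred T) (c : rat) : \sum_(x | P x) c = #|P|%:R * c.
Proof. by rewrite sumr_const mulr_natl. Qed.

Section OneColour.
Variables (T : finType) (e : rel T) (u : T) (f : T -> 'I_5).
Hypothesis e_sym : symmetric e.
Hypothesis e_next : forall x y, x != u -> y != u -> f y = f x + 1 -> e x y.

Definition blob (i : 'I_5) : nat := #|[pred x | (x != u) && (f x == i)]|.
Definition link (i : 'I_5) : nat := #|[pred x | [&& x != u, f x == i & e u x]]|.

(* [p i] and [q i] are the weights that an edge inside blob [i] gives to each apex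
   in blob [i + 1] and [i - 1]; [m i] is the weight of a free triangle on [u] and
   the blobs [i], [i + 1]; [C i] bounds the load of the edges between these blobs. *)
Variables p q m C : 'I_5 -> rat.
Hypothesis p_ge0 : forall i, 0 <= p i.
Hypothesis q_ge0 : forall i, 0 <= q i.
Hypothesis m_ge0 : forall i, 0 <= m i.
Hypothesis pq1 : forall i, (blob (i + 1))%:R * p i + (blob (i - 1))%:R * q i = 1.
Hypothesis side_le : forall i,
  ((blob i)%:R - 1) * p i + ((blob (i + 1))%:R - 1) * q (i + 1) + m i <= C i.
Hypothesis C_le1 : forall i, C i <= 1.
Hypothesis spoke_le : forall i,
  (link (i + 1))%:R * m i + (link (i - 1))%:R * m (i - 1) <= 1.

Let inner x y := [&& x != u, y != u, x != y, f x == f y & e x y].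

(* The factor 1/2 is there because [x y] and [y x] are the same inner edge. *)
Let gA x y z : rat :=
  if inner x y && (z != u) then
    if f z == f x + 1 then p (f x) / 2%:R
    else if f x == f z + 1 then q (f x) / 2%:R else 0
  else 0.

(** Each free triangle carries its weight in a single ordering: [u] last, the other two vertices in
    the cyclic order of their blobs. *)
Let gB x y z : rat :=
  if [&& z == u, x != u, y != u, f y == f x + 1, e u x & e u y] then m (f x) else 0.

Let innerC x y : inner x y = inner y x.
Proof.
rewrite /inner e_sym [y == x]eq_sym [f y == f x]eq_sym.
by case: (x != u); case: (y != u).
Qed.

Let gA_ge0 x y z : 0 <= gA x y z.
Proof. by rewrite /gA; do 3?case: ifP => // _; rewrite divr_ge0. Qed.

Let gB_ge0 x y z : 0 <= gB x y z.
Proof. by rewrite /gB; case: ifP. Qed.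

Let gA_sym x y z : gA x y z = gA y x z.
Proof.
by rewrite /gA innerC; have [/and5P[_ _ _ /eqP -> _]|] := boolP (inner y x).
Qed.

Let gA_flow : tri_flow e gA.
Proof.
split=> // x y z; rewrite /gA.
case: ifP; last by rewrite eqxx.
move=> /andP[/and5P[xu yu xy /eqP fxy exy] zu] gn0.
have [n1 n2 _] := ord5_neq (f x); have [_ _ n3] := ord5_neq (f z).
have fz : f z = f x + 1 \/ f x = f z + 1.
  by move: gn0; case: (f z =P f x + 1) => [|_]; [left|case: (f x =P f z + 1) => [|_]; [right|rewrite eqxx]].
have [exz eyz] : e x z /\ e y z.
  case: fz => fz; first by rewrite !e_next // -?fxy.
  by rewrite e_sym e_next // e_sym e_next // -fxy.
split; split=> //.
- apply/negP => /eqP xz; case: fz => /eqP; rewrite -xz ?n1 //.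
- apply/negP => /eqP yz; case: fz => /eqP; rewrite -yz -fxy ?n1 //.
Qed.

Let gB_flow : tri_flow e gB.
Proof.
split=> // x y z; rewrite /gB.
case: ifP; last by rewrite eqxx.
move=> /and5P[/eqP -> xu yu /eqP fy /andP[ux uy]] _.
split; split=> //; last by rewrite e_sym.
- by apply/eqP => exy; have [n1 _ _] := ord5_neq (f x); rewrite -fy exy eqxx in n1.
- exact: e_next.
- by rewrite e_sym.
Qed.

Let sum_blob i (c : rat) :
  \sum_z (if (z != u) && (f z == i) then c else 0) = (blob i)%:R * c.
Proof. by rewrite -big_mkcond sum_const_card. Qed.

Let sum_link i (c : rat) :
  \sum_z (if [&& z != u, f z == i & e u z] then c else 0) = (link i)%:R * c.
Proof. by rewrite -big_mkcond sum_const_card. Qed.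

Let pred_ord (i j : 'I_5) : (i == j + 1) = (j == i - 1).
Proof. by rewrite eq_sym -subr_eq opprK // addrC. Qed.

(** By [pq1] the apexes in the two neighbouring blobs cover an inner edge completely, one half for
    each order of its ends. *)
Let sum_gA x y : \sum_z gA x y z = (inner x y)%:R / 2%:R.
Proof.
have [ixy|nxy] := boolP (inner x y); last first.
  by rewrite mul0r big1 // => z _; rewrite /gA (negbTE nxy).
rewrite mul1r /gA; move: (2%:R^-1) => c.
rewrite -[RHS]mul1r -(pq1 (f x)) mulrDl -!mulrA -sum_blob -sum_blob -big_split.
apply: eq_bigr => z _ /=; rewrite ixy /= (pred_ord (f x)).
have [zu|] := boolP (z != u) => /=; last by rewrite addr0.
case: (f z =P f x + 1) => [-> |_] /=; last by rewrite add0r.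
suff -> : (f x + 1 == f x - 1) = false by rewrite addr0.
by case: (f x) => [[|[|[|[|[|i]]]]] lti].
Qed.

(** The apex of a triangle of [gA] lies outside the blob of its base, so a pair inside a blob is
    loaded only as a base. *)
Let load_gA_in x y : x != y -> f x = f y -> load gA x y <= 1.
Proof.
move=> nxy fxy; rewrite /load.
have z0 a b z : f a = f b -> gA a z b = 0.
  move=> fab; rewrite /gA; case: ifP => // /andP[/and5P[_ _ _ /eqP fz _] _].
  by have [n1 n2 _] := ord5_neq (f a); rewrite -fab n1.
under eq_bigr => z _ do rewrite (z0 _ _ z fxy) (z0 _ _ z (esym fxy)) ![gA z _ _]gA_sym
  (z0 _ _ z fxy) (z0 _ _ z (esym fxy)) !addr0 [gA y x z]gA_sym.
rewrite big_split /= sum_gA; case: (inner x y) => /=; lra.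
Qed.

(** The third vertex of a triangle of [gA] on [x y] completes a base with [x] or with [y] inside the
    same blob. The end itself is excluded, hence the [- 1]. *)
Let load_gA_next x y : x != u -> y != u -> f y = f x + 1 ->
  load gA x y <= ((blob (f x))%:R - 1) * p (f x) + ((blob (f y))%:R - 1) * q (f y).
Proof.
move=> xu yu fy; have [n1 n2 n3] := ord5_neq (f x).
have bound a (c : rat) : a != u ->
    \sum_z (if [&& z != u, z != a & f z == f a] then c else 0) = ((blob (f a))%:R - 1) * c.
  move=> au; rewrite mulrBl mul1r -sum_blob [in RHS](bigD1 a) //= au eqxx /=.
  rewrite addrC addrK (bigD1 a) //= eqxx andbF add0r.
  by apply: eq_bigr => z za; rewrite za.
rewrite -!bound // -big_split; apply: ler_sum => z _ /=.
have -> : gA x y z = 0 by rewrite /gA /inner fy n1 !andbF.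
have -> : gA y x z = 0 by rewrite gA_sym /gA /inner fy n1 !andbF.
rewrite ![gA z _ _]gA_sym !add0r.
have hx : gA x z y <= (if [&& z != u, z != x & f z == f x] then p (f x) else 0) / 2%:R.
  rewrite /gA /inner fy eqxx [x == z]eq_sym [f x == f z]eq_sym.
  case: (z != u); case: (z != x); case: (f z == f x); rewrite ?andbF ?mul0r //=.
  by case: ifP => // _; apply: divr_ge0.
have hy : gA y z x <= (if [&& z != u, z != y & f z == f y] then q (f y) else 0) / 2%:R.
  rewrite /gA /inner fy eqxx -fy [y == z]eq_sym [f y == f z]eq_sym.
  have -> : (f x == f y + 1) = false by rewrite fy n2.
  case: (z != u); case: (z != y); case: (f z == f y); rewrite ?andbF ?mul0r //=.
  by case: ifP => // _; apply: divr_ge0.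
lra.
Qed.

Let load_gA_far x y :
  [|| x == u, y == u | [&& f y != f x, f y != f x + 1 & f x != f y + 1]] ->
  load gA x y = 0.
Proof.
move=> far; apply: big1 => z _.
have z1 a b c : [|| a == u, b == u | f a != f b] -> gA a b c = 0.
  by move=> h; rewrite /gA /inner; case: (a == u) h; case: (b == u); case: (f a == f b);
    rewrite //= ?andbF.
have z2 a b c : [|| a == u, c == u | (f c != f a + 1) && (f a != f c + 1)] -> gA a b c = 0.
  move=> h; rewrite /gA /inner; case: (a == u) h => //=; case: (c == u); rewrite /= ?andbF //.
  by move=> /andP[/negbTE -> /negbTE ->]; rewrite if_same.
have [h1 h2 h3 h4] : [/\ gA x y z = 0, gA y x z = 0, gA x z y = 0 & gA y z x = 0].
  split; [apply: z1|apply: z1|apply: z2|apply: z2]; move: far;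
    rewrite [f y == f x]eq_sym; case: (x == u); case: (y == u) => //= /and3P[a1 a2 a3];
    by rewrite ?a1 ?a2 ?a3 // eq_sym a1.
by rewrite ![gA z _ _]gA_sym h1 h2 h3 h4 !addr0.
Qed.

Let load_gB_far x y :
  [|| x == y, (x == u) && (y == u) | [&& x != u, y != u, f y != f x + 1 & f x != f y + 1]] ->
  load gB x y = 0.
Proof.
move=> far; apply: big1 => z _.
have z1 a b c : [|| a == u, b == u | f b != f a + 1] -> gB a b c = 0.
  by rewrite /gB; case: (a == u); case: (b == u); case: (f b == f a + 1); rewrite /= ?andbF.
have z2 a b c : c != u -> gB a b c = 0 by rewrite /gB => /negbTE ->.
have [/eqP exy|] := boolP (x == y).
  rewrite -exy; have [n1 _ _] := ord5_neq (f x).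
  rewrite z1 ?n1 ?orbT // !add0r.
  have [xu|xu] := boolP (x == u).
    by rewrite !z1 ?xu ?orbT // !addr0.
  by rewrite !z2 // !addr0.
move: far => /orP[-> //|/orP[/andP[xu yu] _|/and4P[xu yu n1 n2] _]].
  by rewrite !z1 ?xu ?yu ?orbT // !addr0.
rewrite (z1 x y) ?n1 ?orbT // (z1 y x) ?n2 ?orbT //.
by rewrite !z2 // !addr0.
Qed.

Let load_gB_next x y : x != u -> y != u -> f y = f x + 1 -> load gB x y <= m (f x).
Proof.
move=> xu yu fy; rewrite /load (bigD1 u) //= [X in _ + X]big1 ?addr0; last first.
  move=> z /negbTE zu; rewrite /gB zu (negbTE xu) (negbTE yu) /=.
  by rewrite !addr0.
have [n1 n2 n3] := ord5_neq (f x).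
rewrite /gB fy n2 eqxx /= !andbF (negbTE xu) (negbTE yu) /= !addr0.
by case: ifP.
Qed.

(** The third vertex of a free triangle on [u x] is a neighbour of [u] in one of the two blobs next
    to that of [x]; these are the two terms of [spoke_le]. *)
Let load_gB_spoke x : x != u -> load gB x u <= 1.
Proof.
move=> xu; apply: le_trans (spoke_le (f x)).
rewrite -!sum_link -big_split; apply: ler_sum => z _ /=.
rewrite /gB (negbTE xu) eqxx /= !andbF /= !add0r.
have -> : f x == f z + 1 = (f z == f x - 1) by exact: pred_ord.
have mz : f z == f x - 1 -> m (f z) = m (f x - 1) by move/eqP ->.
case: (boolP (f z == f x - 1)) mz => [/eqP -> /(_ isT)|_ _];
  rewrite ?andbF /= ?addr0.
  have -> : (f x - 1 == f x + 1) = false by case: (f x) => [[|[|[|[|[|i]]]]] lti].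
  rewrite ?andbF /= add0r => _.
  by case: (z != u); case: (e u z); case: (e u x); rewrite /= ?add0r ?m_ge0.
by case: (z != u); case: (e u z); case: (f z == f x + 1); case: (e u x); rewrite /= ?m_ge0.
Qed.

Definition colour_flow x y z := gA x y z + gB x y z.

Lemma colour_flow_tri : tri_flow e colour_flow.
Proof.
have [_ hA] := gA_flow; have [_ hB] := gB_flow.
split=> x y z; first by rewrite addr_ge0.
rewrite /colour_flow; have [/eqP ->|/hA//] := boolP (gA x y z == 0).
by rewrite add0r => /hB.
Qed.

Lemma colour_flow_value :
  flow_value colour_flow =
    (#|[pred w : T * T | [&& w.1 != u, w.2 != u, w.1 != w.2, f w.1 == f w.2 & e w.1 w.2]]|)%:R / 2%:R
    + \sum_i (link i)%:R * (link (i + 1))%:R * m i.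
Proof.
rewrite flow_valueD; congr (_ + _).
  rewrite /flow_value; under eq_bigr => x _ do under eq_bigr => y _ do rewrite sum_gA.
  rewrite pair_bigA /= -mulr_suml; congr (_ / _).
  rewrite -sum1_card natr_sum [RHS]big_mkcond; apply: eq_bigr => -[x y] _ /=.
  by rewrite inE /inner; case: ifP => //= ->.
rewrite /flow_value (partition_big f predT) //=; apply: eq_bigr => i _.
rewrite -mulrA -sum_link [RHS]big_mkcond [LHS]big_mkcond; apply: eq_bigr => x _ /=.
have [/eqP fx|] := boolP (f x == i); last by rewrite andbF.
have gBu y : \sum_z gB x y z = gB x y u.
  rewrite (bigD1 u) //= big1 ?addr0 // => z /negbTE zu; by rewrite /gB zu.
under eq_bigr => y _ do rewrite gBu.
rewrite -sum_link /= /gB fx eqxx /=.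
case: (x != u); case: (e u x) => //=; apply: big1 => y _; rewrite ?andbF //.
Qed.

Lemma colour_load_side x y : x != u -> y != u -> f y = f x + 1 ->
  load colour_flow x y <= C (f x).
Proof.
move=> xu yu fy; rewrite loadD; apply: le_trans (side_le (f x)).
by rewrite lerD ?load_gB_next // -fy load_gA_next.
Qed.

Lemma colour_load_le1 x y : x != y -> load colour_flow x y <= 1.
Proof.
move=> nxy.
have sideP a b : a != u -> b != u -> f b = f a + 1 -> load colour_flow a b <= 1.
  by move=> au bu fb; apply: le_trans (C_le1 (f a)); apply: colour_load_side.
have spokeP a : a != u -> load colour_flow a u <= 1.
  by move=> au; rewrite loadD load_gA_far ?eqxx ?orbT // add0r load_gB_spoke.
have [/eqP xu|xu] := boolP (x == u).
  by rewrite xu loadC spokeP // -xu eq_sym.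
have [/eqP yu|yu] := boolP (y == u); first by rewrite yu spokeP.
have [/eqP|n1] := boolP (f y == f x + 1); first exact: sideP.
have [/eqP|n2] := boolP (f x == f y + 1); first by rewrite loadC; apply: sideP.
rewrite loadD load_gB_far ?xu ?yu ?n1 ?n2 ?orbT // addr0.
have [/eqP|n0] := boolP (f x == f y); first exact: load_gA_in.
by rewrite load_gA_far // [f y == f x]eq_sym n0 n1 n2 !orbT.
Qed.

Lemma colour_load_far x y : x != u -> y != u ->
  [&& f y != f x, f y != f x + 1 & f x != f y + 1] -> load colour_flow x y = 0.
Proof.
move=> xu yu far; have /and3P[_ n1 n2] := far.
by rewrite loadD load_gA_far ?far ?orbT // load_gB_far ?addr0 // xu yu n1 n2 !orbT.
Qed.

End OneColour.

Definition inner_pairs (T : finType) (e : rel T) (u : T) (f : T -> 'I_5) : pred (T * T) :=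
  [pred w | [&& w.1 != u, w.2 != u, w.1 != w.2, f w.1 == f w.2 & e w.1 w.2]].

(* [F i] is the total load, on all edges between blobs [i] and [i + 1], caused by
   the edges inside blob [i], so [F] is a flow around the pentagon; [S i] is the
   capacity reserved for the free triangles of total weight [M i]. *)
Lemma colour_packing (T : finType) (e : rel T) (u : T) (f : T -> 'I_5)
    (F S M K : 'I_5 -> rat) :
  let A := fun i => (blob u f i)%:R : rat in
  let B := fun i => (link e u f i)%:R : rat in
  symmetric e ->
  (forall x y, x != u -> y != u -> f y = f x + 1 -> e x y) ->
  (forall i, 2%:R <= A i) ->
  (forall i, 0 <= F i <= A i * (A i - 1)) -> (forall i, 0 <= S i) ->
  (forall i, 0 <= M i) ->
  (forall i, F i + A (i + 1) * (A (i + 1) - 1) + S i <= K i + F (i + 1)) ->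
  (forall i, K i <= A i * A (i + 1)) ->
  (forall i, M i + M (i - 1) <= B i) ->
  (forall i, M i * (A i * A (i + 1)) <= S i * (B i * B (i + 1))) ->
  exists g, [/\ tri_flow e g,
    flow_value g = #|inner_pairs e u f|%:R / 2%:R + \sum_i M i,
    forall x y, x != y -> load g x y <= 1,
    forall x y, x != u -> y != u -> f y = f x + 1 ->
      load g x y <= K (f x) / (A (f x) * A (f x + 1)) &
    forall x y, x != u -> y != u -> f y != f x -> f y != f x + 1 -> f x != f y + 1 ->
      load g x y = 0].
Proof.
move=> A B e_sym e_next A2 FE S0 M0 side Kle spoke MS.
have A0 i : 0 < A i by apply: lt_le_trans (A2 i).
have A1 i : 0 < A i - 1 by move: (A2 i); lra.
have An i : A i != 0 by rewrite gt_eqF.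
have A1n i : A i - 1 != 0 by rewrite gt_eqF.
have B0 i : 0 <= B i by rewrite ler0n.
(* Counting all C(A i, 2) pairs inside blob [i], each with A (i + 1) apexes and two loaded side
   edges, weight [p i] gives total load A i (A i - 1) A (i + 1) p i. This is set equal to [F i], and
   [q i] sends the remainder to the other side. *)
pose p i := F i / (A i * (A i - 1) * A (i + 1)).
pose q i := (A i * (A i - 1) - F i) / (A i * (A i - 1) * A (i - 1)).
pose m i := M i / (B i * B (i + 1)).
pose C i := K i / (A i * A (i + 1)).
have p0 i : 0 <= p i.
  by have /andP[? _] := FE i; rewrite divr_ge0 // !mulr_ge0 // ltW.
have q0 i : 0 <= q i.
  by have /andP[_ ?] := FE i; rewrite divr_ge0 ?subr_ge0 // !mulr_ge0 // ltW.
have m0 i : 0 <= m i by rewrite divr_ge0 // mulr_ge0.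
have pq1 i : A (i + 1) * p i + A (i - 1) * q i = 1.
  by rewrite /p /q; field; rewrite !An A1n.
have MB i : (B i * B (i + 1)) * m i = M i.
  (* If [u] has no neighbour in one of the two blobs, the last hypothesis forces [M i = 0], in
     agreement with division by 0 giving 0. *)
  rewrite /m mulrC; have [b0|nb] := eqVneq (B i * B (i + 1)) 0; last by rewrite divfK.
  have := MS i; rewrite b0 !mulr0 pmulr_lle0 ?mulr_gt0 // => M_le0.
  by apply/esym/eqP; rewrite eq_le M0 M_le0.
have sideC i : (A i - 1) * p i + (A (i + 1) - 1) * q (i + 1) + m i <= C i.
  have mS : m i <= S i / (A i * A (i + 1)).
    rewrite ler_pdivlMr ?mulr_gt0 // /m.
    have [->|nb] := eqVneq (B i * B (i + 1)) 0; first by rewrite invr0 mulr0 mul0r.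
    have b_gt0 : 0 < B i * B (i + 1) by rewrite lt0r nb mulr_ge0.
    by rewrite mulrAC ler_pdivrMr.
  have -> : (A i - 1) * p i = F i / (A i * A (i + 1)).
    by rewrite /p; field; rewrite !An A1n.
  have -> : (A (i + 1) - 1) * q (i + 1) =
      (A (i + 1) * (A (i + 1) - 1) - F (i + 1)) / (A i * A (i + 1)).
    by rewrite /q addrK; field; rewrite !An A1n.
  apply: le_trans (lerD (lexx _) mS) _; rewrite /C -!mulrDl.
  by rewrite ler_pM2r ?invr_gt0 ?mulr_gt0 //; have := side i; lra.
have C1 i : C i <= 1 by rewrite ler_pdivrMr ?mulr_gt0 // mul1r.
have spoke1 i : B (i + 1) * m i + B (i - 1) * m (i - 1) <= 1.
  (* For [B i = 0] both [m i] and [m (i - 1)] are quotients by 0, hence 0; otherwise the bound is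
     multiplied by [B i]. *)
  have [b0|nb] := eqVneq (B i) 0.
    by rewrite /m subrK b0 mul0r mulr0 invr0 !mulr0 addr0.
  have b_gt0 : 0 < B i by rewrite lt0r nb B0.
  rewrite -(ler_pM2l b_gt0) mulr1.
  have -> : B i * (B (i + 1) * m i + B (i - 1) * m (i - 1)) =
      B i * B (i + 1) * m i + B (i - 1) * B i * m (i - 1) by ring.
  by rewrite MB; have := MB (i - 1); rewrite subrK => ->; apply: spoke.
exists (colour_flow e u f p q m); split.
- exact: colour_flow_tri.
- rewrite colour_flow_value //; congr (_ + _).
  by apply: eq_bigr => i _; exact: MB.
- by move=> x y; apply: (@colour_load_le1 _ _ _ _ _ _ _ _ C).
- by move=> x y; apply: (@colour_load_side _ _ _ _ _ _ _ _ C).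
- move=> x y xu yu n0 n1 n2; apply: colour_load_far => //; by rewrite n0 n1 n2.
Qed.

(** * Integer certificates *)

Local Close Scope ring_scope.

(* [has] and [all] would evaluate both arguments of [||] and [&&] under [vm_compute]. *)
Fixpoint lazy_has (A : Type) (p : A -> bool) (s : seq A) : bool :=
  if s is x :: s' then if p x then true else lazy_has p s' else false.
Fixpoint lazy_all (A : Type) (p : A -> bool) (s : seq A) : bool :=
  if s is x :: s' then if p x then lazy_all p s' else false else true.

Lemma lazy_hasE (A : Type) (p : A -> bool) s : lazy_has p s = has p s.
Proof. by elim: s => //= x s ->; case: (p x). Qed.

Lemma lazy_allP (A : eqType) (p : A -> bool) s x : lazy_all p s -> x \in s -> p x.
Proof.
elim: s => //= y s IHs; case: ifP => // py /IHs xs.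
by rewrite inE => /predU1P[->|].
Qed.

Definition succ5 (i : nat) : nat := nth 0 [:: 1; 2; 3; 4; 0] i.
Definition pred5 (i : nat) : nat := nth 0 [:: 4; 0; 1; 2; 3] i.
Definition entry (s : seq N) (i : nat) : N := nth 0%num s i.
Definition toN : seq nat -> seq N := map N.of_nat.
Definition sum5 (s : seq N) : N :=
  foldr (fun i t => entry s i + t)%num 0%num (iota 0 5).
Definition pairs (a : seq N) : seq N := [seq (x * (x - 1))%num | x <- a].
Definition sides (a : seq N) : seq N :=
  [seq (entry a i * entry a (succ5 i))%num | i <- iota 0 5].
(** The blobs in steps of two: the cyclic order in which consecutive blobs are joined in blue. *)
Definition pentagram (A : Type) (x0 : A) (s : seq A) : seq A :=
  [seq nth x0 s i | i <- [:: 0; 2; 4; 1; 3]].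

(* The hypotheses of [colour_packing] in integers, with [m] in units of 1/12. *)
Definition valid (a r K m s F : seq N) : bool :=
  lazy_all (fun i => let j := succ5 i in
    [&& (entry m i + entry m (pred5 i) <=? 12 * entry r i)%num,
        (entry F i <=? entry (pairs a) i)%num,
        (entry F i + entry (pairs a) j + entry s i <=? entry K i + entry F j)%num,
        (entry K i <=? entry a i * entry a j)%num &
        (entry m i * (entry a i * entry a j)
           <=? 12 * entry s i * (entry r i * entry r j))%num]) (iota 0 5).

Definition feasible (a r : seq nat) (K : seq N) (t : N) : Prop :=
  exists m s F, valid (toN a) (toN r) K m s F /\ (t <= sum5 m)%num.

Local Open Scope ring_scope.

Notation "x %:QN" := ((N.to_nat x)%:R : rat) (at level 2, format "x %:QN").

Lemma QND x y : (x + y)%num%:QN = x%:QN + y%:QN.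
Proof. by rewrite N2Nat.inj_add natrD. Qed.
Lemma QNM x y : (x * y)%num%:QN = x%:QN * y%:QN.
Proof. by rewrite N2Nat.inj_mul natrM. Qed.
Lemma QN_le x y : (x <=? y)%num -> x%:QN <= y%:QN.
Proof. by move/N.leb_le => ?; rewrite ler_nat; lia. Qed.
Lemma QN_pairs x : (x * (x - 1))%num%:QN = x%:QN * (x%:QN - 1).
Proof.
case: x => [|x]; first by rewrite mul0r.
rewrite QNM; congr (_ * _); rewrite N2Nat.inj_sub natrB //; lia.
Qed.
Lemma entry_toN s i : entry (toN s) i = N.of_nat (nth 0%N s i).
Proof.
rewrite /entry /toN; elim: s i => [|x s IHs] [|i] //=.
Qed.
Lemma entry_pairs a i : entry (pairs a) i = (entry a i * (entry a i - 1))%num.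
Proof. by rewrite /entry /pairs; elim: a i => [|x s IHs] [|i] //=. Qed.

Lemma val_succ5 (i : 'I_5) : val (i + 1) = succ5 i.
Proof. by case: i => [[|[|[|[|[|i]]]]] lti]. Qed.
Lemma val_pred5 (i : 'I_5) : val (i - 1) = pred5 i.
Proof. by case: i => [[|[|[|[|[|i]]]]] lti]. Qed.

Lemma sum5E s : \sum_(i < 5) (entry s i)%:QN = (sum5 s)%:QN.
Proof. by rewrite /sum5 !big_ord_recl big_ord0 /= !QND. Qed.

(** Larger neighbourhoods of [u] only relax the conditions, so [r] need only bound the links from
    below; thus one certificate serves many colourings. *)
Lemma certified_packing (T : finType) (e : rel T) (u : T) (f : T -> 'I_5)
    (a r : seq nat) (K : seq N) (t : N) :
  symmetric e ->
  (forall x y, x != u -> y != u -> f y = f x + 1 -> e x y) ->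
  (forall i : 'I_5, nth 0%N a i = blob u f i) ->
  (forall i, (1 < blob u f i)%N) ->
  (forall i : 'I_5, (nth 0%N r i <= link e u f i)%N) ->
  feasible a r K t ->
  exists g, [/\ tri_flow e g,
    #|inner_pairs e u f|%:R / 2%:R + t%:QN / 12%:R <= flow_value g,
    forall x y, x != y -> load g x y <= 1,
    forall x y, x != u -> y != u -> f y = f x + 1 ->
      load g x y <= (entry K (f x))%:QN / (blob u f (f x) * blob u f (f x + 1))%:R &
    forall x y, x != u -> y != u -> f y != f x -> f y != f x + 1 -> f x != f y + 1 ->
      load g x y = 0].
Proof.
move=> e_sym e_next aE a_gt1 r_le [m [s [F [vld tle]]]].
have {}vld (i : 'I_5) :
  [/\ (entry m i)%:QN + (entry m (i - 1)%R)%:QN <= 12%:R * (entry (toN r) i)%:QN,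
      (entry F i)%:QN <= (entry (pairs (toN a)) i)%:QN,
      (entry F i)%:QN + (entry (pairs (toN a)) (i + 1)%R)%:QN + (entry s i)%:QN <=
         (entry K i)%:QN + (entry F (i + 1)%R)%:QN,
      (entry K i)%:QN <= (entry (toN a) i)%:QN * (entry (toN a) (i + 1)%R)%:QN &
      (entry m i)%:QN * ((entry (toN a) i)%:QN * (entry (toN a) (i + 1)%R)%:QN) <=
        12%:R * (entry s i)%:QN * ((entry (toN r) i)%:QN * (entry (toN r) (i + 1)%R)%:QN)].
  have := lazy_allP vld (x := val i).
  rewrite mem_iota ltn_ord -val_succ5 -val_pred5 => /(_ isT)/and5P[h1 h2 h3 h4 h5].
  by split; [move: h1|move: h2|move: h3|move: h4|move: h5] => /QN_le; rewrite ?QND ?QNM.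
have AE (i : 'I_5) : (entry (toN a) i)%:QN = (blob u f i)%:R :> rat.
  by rewrite entry_toN Nat2N.id aE.
have EE (i : 'I_5) : (entry (pairs (toN a)) i)%:QN =
    (blob u f i)%:R * ((blob u f i)%:R - 1) :> rat.
  by rewrite entry_pairs QN_pairs AE.
have RE (i : 'I_5) : (entry (toN r) i)%:QN <= (link e u f i)%:R :> rat.
  by rewrite entry_toN Nat2N.id ler_nat.
pose q (l : seq N) (i : 'I_5) : rat := (entry l i)%:QN.
have q0 l i : 0 <= q l i by rewrite ler0n.
have [||||||||g [g_tri g_val g1 gK gfar]] := @colour_packing T e u f (q F) (q s)
    (fun i => q m i / 12%:R) (q K) e_sym e_next.
- by move=> i; rewrite ler_nat.
- by move=> i; rewrite q0 -EE; have [_] := vld i.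
- by move=> i; apply: q0.
- by move=> i; rewrite divr_ge0.
- by move=> i; rewrite -EE; have [_ _] := vld i.
- by move=> i; rewrite -!AE; have [_ _ _] := vld i.
- by move=> i; have [h _ _ _ _] := vld i; have := RE i; rewrite /q; lra.
- move=> i; rewrite mulrAC ler_pdivrMr // mulrC -!AE.
  have [_ _ _ _ h] := vld i; rewrite -mulrC; apply: le_trans h _.
  rewrite -mulrA [leLHS]mulrC ler_pM2r // ler_wpM2l // ler_pM //.
exists g; split=> //; last by move=> x y xu yu /(gK _ _ xu yu); rewrite natrM.
rewrite g_val lerD2l -mulr_suml ler_pM2r // sum5E.
by apply: QN_le; apply/N.leb_le.
Qed.

(** * The search *)

Local Close Scope ring_scope.

(* [greedy] and [least_flow] only propose certificates; nothing is proved about them.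
   [greedy] fills the sides of the pentagon in the order [o], paying [s i] units of
   spare capacity for the weight [m i]; [least_flow] is the longest-path solution of
   the difference constraints on [F]. *)
Fixpoint greedy (a r : seq N) (o : seq nat) (budget : N) (rem m s : seq N) :=
  if o is i :: o' then
    let j := succ5 i in
    let rr := (entry r i * entry r j)%num in
    let aa := (entry a i * entry a j)%num in
    let v := N.min (N.min (entry rem i) (entry rem j)) (budget * 12 * rr / aa) in
    if (v =? 0)%num then greedy a r o' budget rem m s else
    let c := ((v * aa + (12 * rr - 1)) / (12 * rr))%num in
    greedy a r o' (budget - c)
      (set_nth 0 (set_nth 0 rem i (entry rem i - v)) j (entry rem j - v))%num
      (set_nth 0%num m i v) (set_nth 0%num s i c)
  else (m, s).

Definition zeros : seq N := nseq 5 0%num.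

(** The inner edges load the sides by sum_i a_i (a_i - 1) in total, whatever the flow [F]; the
    budget is what remains of the capacity. *)
Definition greedy_on (a r K : seq N) (o : seq nat) :=
  greedy a r o (sum5 K - sum5 (pairs a))
    [seq (12 * x)%num | x <- r] zeros zeros.

Definition least_flow (a K s : seq N) : seq N :=
  let e := pairs a in
  foldl (fun F i => let j := succ5 i in
    set_nth 0%num F j
      (N.max (entry F j) (entry F i + entry e j + entry s i - entry K i))) zeros
    (iota 0 5 ++ iota 0 5).

Definition arcs5 : seq (seq nat) := [seq rot k (iota 0 5) | k <- iota 0 5].
Definition arcs35 : seq (seq nat) := arcs5 ++ [seq take 3 o | o <- arcs5].

Definition reaches (a r K : seq N) (o : seq nat) (goal : N) : bool :=
  let (m, s) := greedy_on a r K o in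
  if (goal <=? sum5 m)%num then valid a r K m s (least_flow a K s) else false.

Definition best (a r K : seq N) : option N :=
  foldr (fun o b => let (m, s) := greedy_on a r K o in
     if (if b is Some v then (v <? sum5 m)%num else true) then
       if valid a r K m s (least_flow a K s) then Some (sum5 m) else b
     else b) None arcs5.

(* Twice a bound on the weight of free triangles; it only saves time. *)
Definition half_cover (r : seq nat) : nat :=
  foldr minn (sumn r) (flatten [seq
    let: p := nth 0 r (pred5 i) + nth 0 r (succ5 i) in
    let: q' := nth 0 r (pred5 (pred5 i)) in
    [:: p.*2 + nth 0 r (succ5 (succ5 i)) + q'; (p + q').*2] | i <- iota 0 5]).

(** Four times the gap between n(n-1)/4 and 3 sum_i C(a_i, 2), truncated at 0, where n counts [u] as
    well. In units of 1/12, this is the weight that the free triangles of both colours must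
    exceed. *)
Definition deficit (a : seq nat) : N :=
  let n := (sum5 (toN a) + 1)%num in (n * (n - 1) - 6 * sum5 (pairs (toN a)))%num.

Definition rest (a r : seq nat) : seq nat := [seq nth 0 a i - nth 0 r i | i <- iota 0 5].

(** Among link vectors between [lo] and [hi], red is worst at [lo] and blue is worst at [hi], so a
    red certificate for [lo] and a blue one for [a - hi] settle the whole box. *)
Definition test1 (a lo hi : seq nat) : bool :=
  let a' := pentagram 0 a in
  let b := pentagram 0 (rest a hi) in
  let G := deficit a in
  if (6 * N.of_nat (half_cover lo + half_cover b) <=? G)%num then false else
  if best (toN a') (toN b) (sides (toN a')) is Some v then
    lazy_has (fun o => reaches (toN a) (toN lo) (sides (toN a)) o (G + 1 - v)) arcs5
  else false.

(* The flipped edge is red in the blow-up and joins blobs 0 and 1. Its red load is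
   at most [l / (a0 * a1)]; the blue capacity kept free on the edges from blobs 0
   and 1 to blob 3 leaves room for weight [1 / a3] on each triangle on the flipped
   edge with apex in blob 3. *)
Definition red_sides (a : seq nat) (l : N) : seq N := l :: behead (sides (toN a)).
Definition blue_sides (a : seq nat) : seq N :=
  let x := entry (toN a) in
  take 3 (sides (toN (pentagram 0 a))) ++ [:: x 1 * (x 3 - 1); x 0 * (x 3 - 1)]%num.

(** The new triangles on the flipped edge have weight 1, that is 12 units, and dropping the red ones
    costs at most 12 l / q units. The [+ 1] makes the gain strict in spite of the quotient being
    rounded down. *)
Definition test2 (a lo hi : seq nat) : bool :=
  let a' := pentagram 0 a in
  let b := pentagram 0 (rest a hi) in
  let G := deficit a in
  let q := entry (sides (toN a)) 0 in
  if (12 + 6 * N.of_nat (half_cover lo + half_cover b) <=? G)%num then false else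
  if best (toN a') (toN b) (blue_sides a) is Some v then
    lazy_has (fun l => lazy_has (fun o =>
        reaches (toN a) (toN lo) (red_sides a l) o (G + 1 + 12 * l / q - v - 12)) arcs35)
      [seq N.of_nat i | i <- iota 0 10]
  else false.

(** Branch and bound over boxes of link vectors, halving a longest side. The choice of the side does
    not affect soundness. *)
Fixpoint cover (test : seq nat -> seq nat -> bool) (good : seq nat -> bool)
    (k : nat) (lo hi : seq nat) : bool :=
  if test lo hi then true else
  if lo == hi then good lo else
  if k is k'.+1 then
    let w := [seq x.2 - x.1 | x <- zip lo hi] in
    let i := index (foldr maxn 0 w) w in
    let m := (nth 0 lo i + nth 0 hi i)./2 in
    if cover test good k' lo (set_nth 0 hi i m)
    then cover test good k' (set_nth 0 lo i m.+1) hi else false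
  else false.

(* Number of edges at [u] that do not fit if [u] is put into blob [i]. *)
Definition defect (a r : seq nat) (i : nat) : nat :=
  (nth 0 a (pred5 i) - nth 0 r (pred5 i)) + (nth 0 a (succ5 i) - nth 0 r (succ5 i)) +
  nth 0 r (succ5 (succ5 i)) + nth 0 r (pred5 (pred5 i)).

Definition joins (a r : seq nat) (d : nat) (L : seq (seq nat)) : bool :=
  has (fun i => (defect a r i == d) && (sort leq (incr_nth a i) \in L)) (iota 0 5).

(** With one wrongly coloured edge at [u], flipping it gives a blow-up, so the sizes must lie in
    [B2]. When an edge of the smaller colouring is already flipped, no edge at [u] may be wrong. *)
Definition good1 (a r : seq nat) : bool := joins a r 0 B1 || joins a r 1 B2.
Definition good2 (a r : seq nat) : bool := joins a r 0 B2.

(* The fuel [k] stays a variable until the two computations below: the kernel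
   would otherwise unfold [cover] when comparing types. *)
Definition ok1 (k : nat) (a : seq nat) := cover (test1 a) (good1 a) k (nseq 5 0) a.
Definition ok2 (k : nat) (a : seq nat) := cover (test2 a) (good2 a) k (nseq 5 0) a.

Fixpoint lexleq (s t : seq nat) : bool :=
  if s is x :: s' then if t is y :: t' then
    (x < y) || (x == y) && lexleq s' t' else true else true.
Definition canonical (s : seq nat) : bool := all (fun k => lexleq s (rot k s)) (iota 0 5).

Lemma canonical_rot :
  all (fun t => all (fun s => has (fun k => canonical (rot k s)) (iota 0 5)) (permutations t)) B1.
Proof. by vm_compute. Qed.

(** Rotating the blobs is a symmetry, so for a plain blow-up one rotation of each size vector
    suffices. With a flipped edge the rotation is used up in placing that edge between blobs 0 and
    1, so all permutations are searched. *)
Definition all_ok1 k t :=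
  lazy_all (fun s => if canonical s then ok1 k s else true) (permutations t).
Definition all_ok2 k t := lazy_all (ok2 k) (permutations t).

Lemma all_ok1_B1 : lazy_all (all_ok1 40) B1.
Proof. by vm_compute. Qed.

Lemma all_ok2_B2 : lazy_all (all_ok2 40) B2.
Proof. by vm_compute. Qed.

(** * Soundness of the search *)

Lemma reaches_feasible a r K o goal :
  reaches (toN a) (toN r) K o goal -> feasible a r K goal.
Proof.
rewrite /reaches; case: (greedy_on _ _ _ _) => m s.
case: ifP => // /N.leb_le le_goal vld.
by exists m, s, (least_flow (toN a) K s).
Qed.

Lemma best_feasible a r K v : best (toN a) (toN r) K = Some v -> feasible a r K v.
Proof.
rewrite /best; elim: arcs5 v => [|o os IHos] v //=.
case: (greedy_on _ _ _ _) => m s; case: ifP => _; last exact: IHos.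
case: ifP => [vld [<-]|_]; last exact: IHos.
by exists m, s, (least_flow (toN a) K s); split=> //; apply: N.le_refl.
Qed.

Definition order (a : seq nat) : N := (sum5 (toN a) + 1)%num.
Definition le_seq (r s : seq nat) : Prop := forall i, nth 0 r i <= nth 0 s i.

Definition gain1 (a r : seq nat) : Prop := exists r1 b1 t1 t2,
  [/\ le_seq r1 r, le_seq b1 (pentagram 0 (rest a r)),
    feasible a r1 (sides (toN a)) t1,
    feasible (pentagram 0 a) b1 (sides (toN (pentagram 0 a))) t2 &
    (order a * (order a - 1) < t1 + t2 + 6 * sum5 (pairs (toN a)))%num].

(* Multiplied out from the gain [(t1 + t2) / 12 + 1 - l / (a0 * a1)] of free triangles. *)
Definition gain2 (a r : seq nat) : Prop := exists l r1 b1 t1 t2,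
  [/\ le_seq r1 r, le_seq b1 (pentagram 0 (rest a r)),
    feasible a r1 (red_sides a l) t1,
    feasible (pentagram 0 a) b1 (blue_sides a) t2 &
    (entry (sides (toN a)) 0 * (order a * (order a - 1)) + 12 * l <
      entry (sides (toN a)) 0 * (t1 + t2 + 12 + 6 * sum5 (pairs (toN a))))%num].

Lemma le_pentagram s t : le_seq s t -> le_seq (pentagram 0 s) (pentagram 0 t).
Proof. by move=> le_st [|[|[|[|[|i]]]]] //=; rewrite !nth_nil. Qed.

Lemma le_rest a r hi : le_seq r hi ->
  le_seq (pentagram 0 (rest a hi)) (pentagram 0 (rest a r)).
Proof.
move=> le_r; apply: le_pentagram => i.
have [lti|gei] := ltnP i 5; last by rewrite !nth_default ?size_map.
by rewrite !(nth_map 0) ?size_iota // leq_sub2l // le_r.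
Qed.

Lemma test1_gain a lo hi r : le_seq lo r -> le_seq r hi -> test1 a lo hi -> gain1 a r.
Proof.
move=> lo_r r_hi; rewrite /test1; case: ifP => // _.
case best_v: (best _ _ _) => [v|] //; rewrite lazy_hasE => /hasP[o _ /reaches_feasible fe].
do 4!eexists; split; [exact: lo_r|exact: le_rest r_hi|exact: fe|exact: best_feasible best_v|].
by rewrite /deficit -/(order a); move: (order a * _)%num (sum5 (pairs _)) => x y; lia.
Qed.

Lemma test2_gain a lo hi r : (0 < entry (sides (toN a)) 0)%num ->
  le_seq lo r -> le_seq r hi -> test2 a lo hi -> gain2 a r.
Proof.
move=> q_gt0 lo_r r_hi; rewrite /test2; case: ifP => // _.
case best_v: (best _ _ _) => [v|] //; rewrite lazy_hasE => /hasP[l _].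
rewrite lazy_hasE => /hasP[o _ /reaches_feasible fe].
do 5!eexists; split; [exact: lo_r|exact: le_rest r_hi|exact: fe|exact: best_feasible best_v|].
rewrite /deficit -/(order a); move: (order a * _)%num (sum5 (pairs _)) => x y.
move: (entry _ 0) q_gt0 => q q_gt0.
have ql : (12 * l < q * (12 * l / q + 1))%num.
  by rewrite N.add_1_r; apply: N.mul_succ_div_gt; lia.
move: (12 * l / q)%num ql => d ql.
(* Truncated subtraction can only raise [goal], so the lower bound on [goal + v + 12 + 6 * y]
   survives. *)
set goal := (x - 6 * y + 1 + d - v - 12)%num.
have : (q * (x + d + 1) <= q * (goal + v + 12 + 6 * y))%num.
  by apply: N.mul_le_mono_l; rewrite /goal; lia.
lia.
Qed.

(** The bounds on [r] are entrywise with default 0, so when the box is a single vector, [r] agrees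
    with it only entrywise; hence the condition that [good] depends on the entries alone. *)
Lemma cover_sound test (good : seq nat -> bool) k lo hi r :
  (forall s t, (forall i, nth 0 s i = nth 0 t i) -> good s = good t) ->
  cover test good k lo hi -> le_seq lo r -> le_seq r hi ->
  good r \/ exists lo' hi', [/\ le_seq lo' r, le_seq r hi' & test lo' hi'].
Proof.
move=> good_ext; elim: k lo hi => [|k IHk] lo hi /=.
  case: ifP => [? _ ? ?|_]; first by right; exists lo, hi.
  case: eqP => // <- glo lo_r r_hi; left; rewrite -(good_ext lo) // => i.
  by apply/eqP; rewrite eqn_leq lo_r r_hi.
case: ifP => [? _ ? ?|_]; first by right; exists lo, hi.
case: eqP => [<- glo lo_r r_hi|_].
  by left; rewrite -(good_ext lo) // => i; apply/eqP; rewrite eqn_leq lo_r r_hi.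
move: (index _ _) => i; move: (_./2) => m.
case: ifP => // cov1 cov2 lo_r r_hi.
have [le_m|gt_m] := leqP (nth 0 r i) m.
  by apply: IHk cov1 lo_r _ => j; rewrite nth_set_nth /=; case: eqP => [->|].
by apply: IHk cov2 _ r_hi => j; rewrite nth_set_nth /=; case: eqP => [->|].
Qed.

Lemma joins_ext a d L s t : (forall i, nth 0 s i = nth 0 t i) -> joins a s d L = joins a t d L.
Proof. by move=> st; apply: eq_has => i; rewrite /defect !st. Qed.

Lemma nth_nseq0 n : forall r, le_seq (nseq n 0) r.
Proof. by move=> r i; rewrite nth_nseq if_same. Qed.

Lemma ok1_cases k a r : ok1 k a -> le_seq r a -> good1 a r \/ gain1 a r.
Proof.
move=> ok le_ra.
case: (cover_sound _ ok (@nth_nseq0 5 r) le_ra).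
- by move=> s t st; rewrite /good1 !(joins_ext _ _ _ st).
- by left.
- by case=> lo [hi [lo_r r_hi tst]]; right; apply: test1_gain tst.
Qed.

Lemma ok2_cases k a r : (0 < entry (sides (toN a)) 0)%num -> ok2 k a -> le_seq r a ->
  good2 a r \/ gain2 a r.
Proof.
move=> q_gt0 ok le_ra.
case: (cover_sound _ ok (@nth_nseq0 5 r) le_ra).
- by move=> s t st; apply: joins_ext.
- by left.
- by case=> lo [hi [lo_r r_hi tst]]; right; apply: test2_gain tst.
Qed.

Lemma all_ok1P k t a r : all_ok1 k t -> perm_eq a t -> canonical a -> le_seq r a ->
  good1 a r \/ gain1 a r.
Proof.
move=> ok at_ can_a; apply: (@ok1_cases k).
by have := lazy_allP ok (x := a); rewrite mem_permutations can_a; apply.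
Qed.

Lemma all_ok2P k t a r : (0 < entry (sides (toN a)) 0)%num ->
  all_ok2 k t -> perm_eq a t -> le_seq r a -> good2 a r \/ gain2 a r.
Proof.
move=> q_gt0 ok at_; apply: (@ok2_cases k) => //.
by apply: (lazy_allP ok); rewrite mem_permutations.
Qed.

Lemma B1_cases a t r : t \in B1 -> perm_eq a t -> canonical a -> le_seq r a ->
  good1 a r \/ gain1 a r.
Proof. by move/(lazy_allP all_ok1_B1); apply: all_ok1P. Qed.

Lemma B2_cases a t r : (0 < entry (sides (toN a)) 0)%num ->
  t \in B2 -> perm_eq a t -> le_seq r a -> good2 a r \/ gain2 a r.
Proof. by move=> q_gt0 /(lazy_allP all_ok2_B2); apply: all_ok2P. Qed.

Lemma B1_canonical a : (exists2 t, t \in B1 & perm_eq a t) ->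
  exists2 k, (k < 5)%N & canonical (rot k a).
Proof.
case=> t tB at_; have /allP/(_ _ tB)/allP/(_ a) := canonical_rot.
by rewrite mem_permutations => /(_ at_)/hasP[k]; rewrite mem_iota; exists k.
Qed.

Local Open Scope ring_scope.


(** * Packings of both colours *)

Section BlowUp.
Variables (T : finType) (u : T).
Implicit Types (red : rel T) (f : T -> 'I_5).

Definition pentagon red f : Prop := forall x y, x != u -> y != u ->
  (f y = f x + 1 -> red x y) /\ (f y = f x + 1 + 1 -> ~~ red x y).

Definition sizes f : seq nat := [seq blob u f i | i <- enum 'I_5].
Definition links red f : seq nat := [seq link red u f i | i <- enum 'I_5].
(* Tripling turns the steps of length 2, which are blue, into steps of length 1. *)
Definition star f (x : T) : 'I_5 := f x *+ 3.

Lemma nth_enum_map (g : 'I_5 -> nat) (i : 'I_5) : nth 0%N [seq g j | j <- enum 'I_5] i = g i.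
Proof. by rewrite (nth_map i) ?nth_ord_enum // size_enum_ord. Qed.

(** Doubling inverts tripling modulo 5. *)
Lemma starE f x (i : 'I_5) : (star f x == i) = (f x == i *+ 2).
Proof.
by rewrite /star; move: (f x) i => [[|[|[|[|[|a]]]]] lta] [[|[|[|[|[|b]]]]] ltb].
Qed.

Lemma star_next f x y : (star f y == star f x + 1) = (f y == f x + 1 + 1).
Proof.
by rewrite /star; move: (f x) (f y) => [[|[|[|[|[|a]]]]] lta] [[|[|[|[|[|b]]]]] ltb].
Qed.

Lemma nth_pentagram s (i : 'I_5) : nth 0%N (pentagram 0%N s) i = nth 0%N s (i *+ 2 : 'I_5).
Proof. by case: i => [[|[|[|[|[|i]]]]] lti]. Qed.

Lemma blob_star f i : blob u (star f) i = blob u f (i *+ 2).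
Proof. by apply: eq_card => x; rewrite !inE starE. Qed.

Lemma link_star red f i :
  link (blue_rel red) u (star f) i = (blob u f (i *+ 2) - link red u f (i *+ 2))%N.
Proof.
rewrite /blob -(cardID [pred x | red u x] [pred x | (x != u) && (f x == i *+ 2)]).
have -> : link red u f (i *+ 2) =
    #|[predI [pred x | (x != u) && (f x == i *+ 2)] & [pred x | red u x]]|.
  by apply: eq_card => x; rewrite !inE andbA.
by rewrite addKn; apply: eq_card => x; rewrite !inE starE /blue_rel andbA andbC.
Qed.

Lemma card_inner f :
  (#|[pred w : T * T | [&& w.1 != u, w.2 != u, w.1 != w.2 & f w.1 == f w.2]]| =
   \sum_(i : 'I_5) blob u f i * (blob u f i).-1)%N.
Proof.
rewrite -sum1_card (eq_bigl (fun w => (w.1 != u) &&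
  [&& w.2 != u, w.1 != w.2 & f w.1 == f w.2])); last by move=> w; rewrite inE.
rewrite -(pair_big_dep (fun x => x != u) (fun x y => [&& y != u, x != y & f x == f y])
  (fun _ _ => 1%N)) /=.
rewrite (partition_big f predT) //=; apply: eq_bigr => i _.
rewrite (eq_bigr (fun _ => (blob u f i).-1)); last first.
  move=> x /andP[xu /eqP fx]; rewrite sum1_card /blob.
  rewrite [in RHS](cardD1 x) !inE xu fx eqxx add1n /=.
  apply: eq_card => y; rewrite !inE unfold_in /= [x == y]eq_sym [i == _]eq_sym.
  by case: (y == x); rewrite ?andbF.
by rewrite sum_nat_const /blob.
Qed.

(** [f] and [star f] have the same blobs, and each pair inside a blob is red or blue. This makes the
    bound independent of the colouring inside the blobs. *)
Lemma card_inner_colours red f :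
  (#|inner_pairs red u f| + #|inner_pairs (blue_rel red) u (star f)| =
   \sum_(i : 'I_5) blob u f i * (blob u f i).-1)%N.
Proof.
rewrite -card_inner -[RHS](cardID [pred w | red w.1 w.2]); congr (_ + _)%N; apply: eq_card => w.
  by rewrite !inE !andbA.
rewrite !inE /blue_rel /star.
have -> : (f w.1 *+ 3 == f w.2 *+ 3) = (f w.1 == f w.2).
  by move: (f w.1) (f w.2) => [[|[|[|[|[|a]]]]] lta] [[|[|[|[|[|b]]]]] ltb].
by rewrite [RHS]andbC !andbA.
Qed.

Lemma sum_blob_card f : (\sum_(i : 'I_5) blob u f i)%N = #|T|.-1.
Proof.
rewrite /blob (eq_bigr (fun i => \sum_(x | (x != u) && (f x == i)) 1)%N); last first.
  by move=> i _; rewrite sum1_card.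
by rewrite -(partition_big f predT) //= sum1_card cardC1.
Qed.

Lemma order_sizes f : (order (sizes f))%:QN = #|T|%:R :> rat.
Proof.
rewrite /order QND -sum5E /=.
have -> : \sum_(i < 5) (entry (toN (sizes f)) i)%:QN = (#|T|.-1)%:R :> rat.
  rewrite -(sum_blob_card f) natr_sum; apply: eq_bigr => i _.
  by rewrite entry_toN Nat2N.id nth_enum_map.
have T_gt0 : (0 < #|T|)%N by apply/card_gt0P; exists u.
by rewrite -natrD addn1 prednK.
Qed.

Lemma pairs_sizes f : (sum5 (pairs (toN (sizes f))))%:QN =
  (\sum_(i : 'I_5) blob u f i * (blob u f i).-1)%N%:R :> rat.
Proof.
rewrite -sum5E natr_sum; apply: eq_bigr => i _.
rewrite entry_pairs QN_pairs entry_toN Nat2N.id nth_enum_map natrM.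
by case: (blob u f i) => [|b]; rewrite ?mul0r //; congr (_ * _); rewrite -natr1 addrK.
Qed.

(** The one-colour packing is taken for red along [f] and for blue along [star f]. The bounds on
    side loads and the vanishing of the blue load on red sides serve the case of a flipped edge. *)
Lemma two_flows red f (r b : seq nat) (K L : seq N) (t t' : N) :
  symmetric red -> pentagon red f -> (forall i, 1 < blob u f i)%N ->
  le_seq r (links red f) -> le_seq b (pentagram 0%N (rest (sizes f) (links red f))) ->
  feasible (sizes f) r K t -> feasible (pentagram 0%N (sizes f)) b L t' ->
  exists gR gB, [/\ tri_flow red gR /\ tri_flow (blue_rel red) gB,
   (sum5 (pairs (toN (sizes f))))%:QN / 2%:R + (t + t')%num%:QN / 12%:R <=
     flow_value gR + flow_value gB,
   (forall x y, x != y -> load gR x y <= 1) /\ (forall x y, x != y -> load gB x y <= 1),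
   (forall x y, x != u -> y != u -> f y = f x + 1 ->
     load gR x y <= (entry K (f x))%:QN / (blob u f (f x) * blob u f (f x + 1))%:R) /\
   (forall x y, x != u -> y != u -> f y = f x + 1 + 1 -> load gB x y <=
     (entry L (f x *+ 3 : 'I_5))%:QN / (blob u f (f x) * blob u f (f x + 1 + 1))%:R) &
   forall x y, x != u -> y != u -> f y = f x + 1 -> load gB x y = 0].
Proof.
move=> red_sym pent blob_gt1 r_le b_le feasR feasB.
have blue_sym : symmetric (blue_rel red) by move=> x y; rewrite /blue_rel red_sym.
have [||i|i|gR [triR valR loadR sideR _]] := certified_packing red_sym _ _ _ _ feasR (u := u) (f := f).
- by move=> x y xu yu; have [] := pent x y xu yu.
- exact: nth_enum_map.
- exact: blob_gt1.
- by rewrite -(nth_enum_map (link red u f)) r_le.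
have [||i|i|gB [triB valB loadB sideB farB]] :=
    certified_packing blue_sym _ _ _ _ feasB (u := u) (f := star f).
- move=> x y xu yu /eqP; rewrite star_next => /eqP.
  by have [] := pent x y xu yu.
- by move=> i; rewrite nth_pentagram nth_enum_map blob_star.
- by rewrite blob_star.
- apply: leq_trans (b_le i) _; rewrite nth_pentagram.
  by rewrite (nth_map 0%N) ?size_iota // nth_iota // !nth_enum_map link_star.
exists gR, gB; split; [by []| |by []| |].
- rewrite pairs_sizes -(card_inner_colours red) natrD QND.
  by move: valR valB; lra.
- split=> // x y xu yu fy; have := sideB x y xu yu.
  have -> : star f y = star f x + 1 by apply/eqP; rewrite star_next fy.
  move=> /(_ erefl); rewrite !blob_star /star.
  have h (i : 'I_5) : i *+ 3 *+ 2 = i /\ (i *+ 3 + 1) *+ 2 = i + 1 + 1.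
    by split; apply/eqP; case: i => [[|[|[|[|[|i]]]]] lti].
  by have [-> ->] := h (f x).
- move=> x y xu yu fy; apply: farB => //; rewrite /star fy;
  by case: (f x) => [[|[|[|[|[|i]]]]] lti].
Qed.

Lemma pack_gt_flows red gR gB (c : rat) :
  symmetric red -> tri_flow red gR -> tri_flow (blue_rel red) gB ->
  (forall x y, x != y -> load gR x y <= 1) -> (forall x y, x != y -> load gB x y <= 1) ->
  c < 3%:R * (flow_value gR + flow_value gB) -> pack_gt [set: T] red c.
Proof.
move=> red_sym triR triB loadR loadB lt_c.
have blue_sym : symmetric (blue_rel red) by move=> x y; rewrite /blue_rel red_sym.
have [wR packR valR] := flow_packing red_sym triR (fun x y nxy _ => loadR x y nxy).
have [wB packB valB] := flow_packing blue_sym triB (fun x y nxy _ => loadB x y nxy).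
by exists wR, wB; rewrite valR valB.
Qed.

Lemma order_pairs f :
  (order (sizes f) * (order (sizes f) - 1))%num%:QN = (#|T| * (#|T| - 1))%N%:R :> rat.
Proof.
rewrite QN_pairs order_sizes natrM natrB //.
by apply/card_gt0P; exists u.
Qed.

Lemma pack_gt_gain1 red f :
  symmetric red -> pentagon red f -> (forall i, 1 < blob u f i)%N ->
  gain1 (sizes f) (links red f) ->
  pack_gt [set: T] red ((#|T| * (#|T| - 1))%N%:R / 4%:R).
Proof.
move=> red_sym pent blob_gt1 [r [b [t [t' [r_le b_le fR fB lt_t]]]]].
have [gR [gB [[triR triB] val [loadR loadB] _ _]]] :=
  two_flows red_sym pent blob_gt1 r_le b_le fR fB.
apply: (pack_gt_flows (gR := gR) (gB := gB)) => //.
have {}lt_t : (order (sizes f) * (order (sizes f) - 1))%num%:QN <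
    (t + t' + 6 * sum5 (pairs (toN (sizes f))))%num%:QN :> rat.
  by rewrite ltr_nat; lia.
move: lt_t val; rewrite order_pairs; move: (sum5 _) => s5.
rewrite !QND QNM (_ : 6%num%:QN = 6%:R) //; lra.
Qed.

End BlowUp.

(** * A flipped edge *)

Section Flip.
Variables (T : finType) (u : T) (red : rel T) (f : T -> 'I_5) (x y : T).
Hypothesis red_sym : symmetric red.

Lemma flip_sym : symmetric (flip red x y).
Proof.
move=> a b; rewrite /flip red_sym.
by rewrite orbC andbC [(a == x) && _]andbC.
Qed.

Lemma flip_off a b (S : {set T}) : a \in S -> b \in S -> ~~ ((x \in S) && (y \in S)) ->
  flip red x y a b = red a b.
Proof.
move=> aS bS; rewrite /flip; case: ifP => // /orP[]/andP[/eqP ax /eqP bx].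
  by rewrite -ax -bx aS bS.
by rewrite -ax -bx aS bS.
Qed.

Hypothesis pent : pentagon u (flip red x y) f.
Hypotheses (xu : x != u) (yu : y != u) (fx : f x = 0) (fy : f y = 1).
Hypothesis blob_gt1 : forall i, (1 < blob u f i)%N.

Let A i : rat := (blob u f i)%:R.
Let top z := (z != u) && (f z == 1 + 1 + 1).

Let A_gt0 i : 0 < A i. Proof. by rewrite ltr0n ltnW. Qed.

Let nxy : x != y. Proof. by apply/eqP => xy; move: fy; rewrite -xy fx. Qed.

Let red_xy : red x y = false.
Proof.
have [/(_ _) h _] := pent xu yu; move: h; rewrite fx fy add0r => /(_ erefl).
by rewrite /flip !eqxx /= => /negbTE.
Qed.

(** Passing from the blow-up to [red] changes only [x y], from red to blue, so the blue packing of
    the blow-up remains valid and only the red one has to be cut. *)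
Let blue_flip a b : blue_rel (flip red x y) a b -> blue_rel red a b.
Proof.
rewrite /blue_rel /flip; case: ifP => // /orP[]/andP[/eqP -> /eqP ->].
  by rewrite red_xy.
by rewrite red_sym red_xy.
Qed.

Let top_neq z : top z -> (z == x) = false /\ (z == y) = false.
Proof.
move=> /andP[_ /eqP fz]; split; apply/eqP => zx; move: fz; rewrite zx ?fx ?fy => /eqP;
  by rewrite -val_eqE.
Qed.

(* [top] is blob 3, the only one joined in blue to both blobs 0 and 1. *)
Let extra a b c : rat := if [&& a == x, b == y & top c] then (A (1 + 1 + 1))^-1 else 0.

Let sum_top (c : rat) : \sum_z (if top z then c else 0) = A (1 + 1 + 1) * c.
Proof. by rewrite -big_mkcond sum_const_card. Qed.

Let load_extra a b : load extra a b =
  ((a == x) && (b == y))%:R + ((b == x) && (a == y))%:R +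
  (((a == x) && top b)%:R + ((b == x) && top a)%:R +
   (((a == y) && top b)%:R + ((b == y) && top a)%:R)) / A (1 + 1 + 1).
Proof.
have h1 c d : \sum_z extra c d z = ((c == x) && (d == y))%:R.
  rewrite /extra; case: (c == x); case: (d == y) => /=; try exact: big1.
  by rewrite sum_top divff // gt_eqF.
have h2 c d : \sum_z extra c z d = ((c == x) && top d)%:R / A (1 + 1 + 1).
  rewrite (bigD1 y) //= big1 ?addr0 => [|z /negbTE zy]; last by rewrite /extra zy andbF.
  by rewrite /extra eqxx /=; case: ifP => _; rewrite ?mul1r ?mul0r.
have h3 c d : \sum_z extra z c d = ((c == y) && top d)%:R / A (1 + 1 + 1).
  rewrite (bigD1 x) //= big1 ?addr0 => [|z /negbTE zx]; last by rewrite /extra zx.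
  by rewrite /extra eqxx /=; case: ifP => _; rewrite ?mul1r ?mul0r.
by rewrite /load !big_split /= !h1 !h2 !h3; lra.
Qed.

Let flow_value_extra : flow_value extra = 1.
Proof.
rewrite /flow_value (bigD1 x) //= [X in _ + X]big1 ?addr0; last first.
  by move=> a /negbTE ax; rewrite big1 // => b _; rewrite big1 // => c _; rewrite /extra ax.
rewrite (bigD1 y) //= [X in _ + X]big1 ?addr0; last first.
  by move=> b /negbTE bx; rewrite big1 // => c _; rewrite /extra bx andbF.
by rewrite /extra !eqxx /= sum_top divff // gt_eqF.
Qed.

Let extra_tri : tri_flow (blue_rel red) extra.
Proof.
split=> a b c; first by rewrite /extra; case: ifP => // _; rewrite invr_ge0 ltW.
rewrite /extra; case: ifP; last by rewrite eqxx.
move=> /and3P[/eqP -> /eqP -> tc] _; have [cx cy] := top_neq tc.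
have /andP[cu /eqP fc] := tc.
split; first by rewrite nxy [x == c]eq_sym [y == c]eq_sym cx cy.
split; first by rewrite /blue_rel red_xy.
  apply: blue_flip; rewrite /blue_rel flip_sym.
  by have [_] := pent cu xu; apply; rewrite fx fc; apply/eqP.
by apply: blue_flip; have [_] := pent yu cu; apply; rewrite fy fc.
Qed.

Lemma tri_flowD (e : rel T) g h :
  tri_flow e g -> tri_flow e h -> tri_flow e (fun a b c => g a b c + h a b c).
Proof.
move=> [g0 gt] [h0 ht]; split=> a b c; first by rewrite addr_ge0.
have [/eqP ->|/gt//] := boolP (g a b c == 0).
by rewrite add0r => /ht.
Qed.

Definition cut (g : T -> T -> T -> rat) a b c : rat :=
  if (x \in triple_set (a, b, c)) && (y \in triple_set (a, b, c)) then 0 else g a b c.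

Lemma cut_tri g : tri_flow (flip red x y) g -> tri_flow red (cut g).
Proof.
move=> [g0 gt]; split=> a b c; rewrite /cut; first by case: ifP.
case: ifP => [|/negbT off]; first by rewrite eqxx.
move=> /gt[nabc [eab eac ebc]]; split=> //.
by split; rewrite -(flip_off _ _ off) // !inE eqxx ?orbT.
Qed.

(** The triangles removed are those through [x y], whose total weight is at most the load of that
    edge. *)
Lemma cut_value (e : rel T) g : tri_flow e g ->
  flow_value g - load g x y <= flow_value (cut g).
Proof.
move=> gt; rewrite lerBlDr /flow_value !sum_triples.
apply: le_trans (lerD (lexx _) (sum_through_le_load gt nxy)).
rewrite [X in _ + X]big_mkcond -big_split; apply: ler_sum => -[[a b] c] _ /=.
by rewrite /cut; case: ifP; rewrite ?add0r ?addr0.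
Qed.

Lemma cut_le (e : rel T) g a b c : tri_flow e g -> cut g a b c <= g a b c.
Proof. by move=> [g0 _]; rewrite /cut; case: ifP. Qed.

(** The edge [x y] joins consecutive blobs, so [g] leaves it free for the full weight 1 of the new
    triangles. An edge from [x] or [y] to blob 3 gains the inverse of the size of that blob, which
    is the room left by the last two bounds on [g]. *)
Lemma load_with_extra g :
  (forall a b, a != b -> load g a b <= 1) ->
  (forall a b, a != u -> b != u -> f b = f a + 1 -> load g a b = 0) ->
  (forall c, top c -> load g x c <= 1 - (A (1 + 1 + 1))^-1) ->
  (forall c, top c -> load g y c <= 1 - (A (1 + 1 + 1))^-1) ->
  forall a b, a != b -> load (fun a b c => g a b c + extra a b c) a b <= 1.
Proof.
move=> load_g g_xy g_x g_y.
have simp := (andbF, andbT, mulr0n, mulr1n, mul0r, mul1r, add0r, addr0).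
have tx : top x = false by apply/negP => /top_neq[]; rewrite eqxx.
have ty : top y = false by apply/negP => /top_neq[_]; rewrite eqxx.
have yx : (y == x) = false by rewrite eq_sym (negbTE nxy).
have xy : (x == y) = false by rewrite (negbTE nxy).
have gxy : load g x y = 0 by apply: g_xy; rewrite // fx fy add0r.
have core a b : a != b -> (a == x) || (a == y) ->
    load (fun a b c => g a b c + extra a b c) a b <= 1.
  move=> nab; rewrite loadD load_extra => /orP[]/eqP ea; move: nab; rewrite ea => nab.
    rewrite eqxx xy [b == x]eq_sym (negbTE nab) tx ?simp /=.
    have [/eqP ->|nby] := boolP (b == y); first by rewrite gxy ty ?simp.
    have [/g_x tb|_] := boolP (top b); last by rewrite ?simp load_g.
    by rewrite ?simp; lra.
  rewrite eqxx yx [b == y]eq_sym (negbTE nab) ty ?simp /=.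
  have [/eqP ->|nbx] := boolP (b == x); first by rewrite loadC gxy tx ?simp.
  have [/g_y tb|_] := boolP (top b); last by rewrite ?simp load_g.
  by rewrite ?simp; lra.
move=> a b nab; have [|/norP[nax nay]] := boolP ((a == x) || (a == y)); first exact: core.
have [|/norP[nbx nby]] := boolP ((b == x) || (b == y)).
  by rewrite loadC; apply: core; rewrite eq_sym.
rewrite loadD load_extra (negbTE nax) (negbTE nay) (negbTE nbx) (negbTE nby) /=.
by rewrite ?simp load_g.
Qed.

Lemma pack_gt_gain2 :
  gain2 (sizes u f) (links u (flip red x y) f) ->
  pack_gt [set: T] red ((#|T| * (#|T| - 1))%N%:R / 4%:R).
Proof.
move=> [l [r [b [t [t' [r_le b_le fR fB lt_t]]]]]].
have [gR [gB [[triR triB] val [loadR loadB] [sideR sideB] farB]]] :=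
  two_flows flip_sym pent blob_gt1 r_le b_le fR fB.
have loadxy : load gR x y <= l%:QN / (A 0 * A 1).
  by have := sideR x y xu yu; rewrite fx fy add0r natrM; apply.
have {}triB : tri_flow (blue_rel red) gB.
  case: triB => g0 gt; split=> // a b' c /gt[? [? ? ?]]; split=> //.
  by split; apply: blue_flip.
have aE (i : 'I_5) : (entry (toN (sizes u f)) i)%:QN = A i.
  by rewrite entry_toN Nat2N.id nth_enum_map.
have predE (i : 'I_5) : (entry (toN (sizes u f)) i - 1)%num%:QN = A i - 1 :> rat.
  by rewrite entry_toN nth_enum_map N2Nat.inj_sub Nat2N.id natrB // ltnW.
(* Spread over all edges between the two blobs, the reduced capacity in [blue_sides] leaves exactly
   [1 / A j] free on each edge. *)
have frac i j : A i * (A j - 1) / ((blob u f i)%:R * (blob u f j)%:R) = 1 - (A j)^-1.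
  by rewrite invfM mulrACA divff ?gt_eqF // mul1r mulrBl divff ?gt_eqF // mul1r.
have topE c : top c -> [/\ c != u, f c = f y + 1 + 1 & f x = f c + 1 + 1].
  by move=> /andP[cu /eqP fc]; split; rewrite // ?fc ?fx ?fy; apply/eqP.
have yTop c : top c -> load gB y c <= 1 - (A (1 + 1 + 1))^-1.
  move=> /topE[cu fc _]; apply: le_trans (sideB y c yu cu fc) _; rewrite fy.
  have -> : (entry (blue_sides (sizes u f)) (1 *+ 3 : 'I_5))%:QN = A 1 * (A (1 + 1 + 1) - 1) :> rat.
    by rewrite -(aE 1) -predE -QNM.
  by rewrite natrM frac.
have xTop c : top c -> load gB x c <= 1 - (A (1 + 1 + 1))^-1.
  move=> tc; have [cu _ fxc] := topE c tc; have /andP[_ /eqP fc] := tc.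
  rewrite loadC; apply: le_trans (sideB c x cu xu fxc) _; rewrite -fxc fx fc.
  have -> : (entry (blue_sides (sizes u f)) ((1 + 1 + 1) *+ 3 : 'I_5))%:QN = A 0 * (A (1 + 1 + 1) - 1) :> rat.
    by rewrite -(aE 0) -predE -QNM.
  by rewrite natrM [X in _ / X]mulrC frac.
apply: (pack_gt_flows (gR := cut gR) (gB := fun a b c => gB a b c + extra a b c)) => //.
- exact: cut_tri.
- exact: tri_flowD.
- move=> a c nac; apply: le_trans (loadR a c nac); apply: ler_load => *; exact: cut_le triR.
- by apply: load_with_extra; [exact: loadB|exact: farB|exact: xTop|exact: yTop].
rewrite flow_valueD flow_value_extra.
have cutv := cut_value triR.
have A01 : 0 < A 0 * A 1 by rewrite mulr_gt0.
have qE : (entry (sides (toN (sizes u f))) 0)%:QN = A 0 * A 1.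
  by rewrite -(aE 0) -(aE 1) -QNM.
have {}lt_t : #|T|%:R * (#|T|%:R - 1) + 12%:R * (l%:QN / (A 0 * A 1)) <
    t%:QN + t'%:QN + 12%:R + 6%:R * (sum5 (pairs (toN (sizes u f))))%:QN :> rat.
  have : (A 0 * A 1) * (#|T| * (#|T| - 1))%N%:R + 12%:R * l%:QN <
      (A 0 * A 1) * (t%:QN + t'%:QN + 12%:R + 6%:R * (sum5 (pairs (toN (sizes u f))))%:QN) :> rat.
    rewrite -qE -(order_pairs u f) -[12%:R]/(12%num%:QN) -[6%:R]/(6%num%:QN).
    by rewrite -!QNM -!QND -QNM ltr_nat; lia.
  move: (sum5 _) => s5; rewrite natrM natrB; last by apply/card_gt0P; exists u.
  move: (A 0 * A 1) A01 => q q_gt0 lt_q; rewrite -(ltr_pM2l q_gt0) [ltLHS]mulrDr.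
  have -> // : q * (12%:R * (l%:QN / q)) = 12%:R * l%:QN.
  by rewrite mulrCA [q * _]mulrC divfK // gt_eqF.
move: val cutv loadxy lt_t; rewrite QND natrM natrB; last by apply/card_gt0P; exists u.
move: (sum5 _) => s5; lra.
Qed.

End Flip.

(** * The structure of the remaining colourings *)

Section Structure.
Variable T : finType.
Implicit Types (V : {set T}) (red : rel T) (f : T -> 'I_5) (u x y : T).

Lemma pentagon_blowupP V red f : pentagon_blowup V red f <->
  (forall i, exists2 x, x \in V & f x = i) /\
  (forall x y, x \in V -> y \in V ->
     (f y = f x + 1 -> red x y) /\ (f y = f x + 1 + 1 -> ~~ red x y)).
Proof.
have h1 x y : (val (f y) == (val (f x) + 1) %% 5)%N = (f y == f x + 1).
  by rewrite -val_eqE.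
have h2 x y : (val (f y) == (val (f x) + 2) %% 5)%N = (f y == f x + 1 + 1).
  by rewrite -val_eqE; case: (f x) => [[|[|[|[|[|i]]]]] lti].
split=> [[ex col]|[ex col]].
  split=> [i|x y xV yV].
    by have /existsP[x /andP[xV /eqP fx]] := ex i; exists x.
  have [c1 c2] := col x y xV yV.
  by split=> e; [apply: c1; rewrite h1 e|apply: c2; rewrite h2 e].
split=> [i|x y xV yV].
  by have [x xV fx] := ex i; apply/existsP; exists x; rewrite xV fx eqxx.
have [c1 c2] := col x y xV yV.
by rewrite h1 h2; split=> /eqP.
Qed.

Lemma eq_pentagon_blowup V red red' f :
  (forall x y, x \in V -> y \in V -> f x != f y -> red x y = red' x y) ->
  pentagon_blowup V red f -> pentagon_blowup V red' f.
Proof.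
move=> eq_red /pentagon_blowupP[ex col]; apply/pentagon_blowupP; split=> // x y xV yV.
have [c1 c2] := col x y xV yV; have [n1 n2 _] := ord5_neq (f x).
by split=> fy; rewrite -eq_red ?fy ?n1 ?n2 //; [apply: c1|apply: c2].
Qed.

Lemma blob_sizes_perm V f (h : 'I_5 -> 'I_5) : injective h ->
  perm_eq (blob_sizes V (h \o f)) (blob_sizes V f).
Proof.
move=> h_inj; have hK := f_invF h_inj; have Kh := invF_f h_inj.
have -> : blob_sizes V (h \o f) =
    [seq #|[set x in V | f x == j]| | j <- [seq invF h_inj i | i <- enum 'I_5]].
  rewrite -map_comp; apply: eq_map => i /=; apply: eq_card => x.
  by rewrite !inE /= -[in RHS](inj_eq h_inj) hK.
apply: perm_map; apply: uniq_perm; rewrite ?(map_inj_uniq (can_inj hK)) ?enum_uniq //.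
by move=> i; rewrite mem_enum; apply/mapP; exists (h i); rewrite ?mem_enum ?Kh.
Qed.

(** The pentagon is isomorphic to its complement, and tripling the indices is an isomorphism. *)
Lemma pentagon_blowup_star V red red' f : symmetric red ->
  (forall x y, red' x y = ~~ red x y) ->
  pentagon_blowup V red f -> pentagon_blowup V red' (star f).
Proof.
move=> red_sym red'E /pentagon_blowupP[ex col]; apply/pentagon_blowupP; split=> [i|x y xV yV].
  have [x xV fx] := ex (i *+ 2); exists x => //; apply/eqP; by rewrite starE fx.
have [_ c2] := col x y xV yV; have [c1 _] := col y x yV xV.
rewrite red'E negbK red_sym.
split=> /eqP e; last apply: c1; last apply/eqP; first by rewrite red_sym; apply/c2/eqP; rewrite -star_next.
by move: e; rewrite /star; move: (f x) (f y) => [[|[|[|[|[|a]]]]] lta] [[|[|[|[|[|b]]]]] ltb].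
Qed.

Lemma star_inj : injective (fun i : 'I_5 => i *+ 3).
Proof.
move=> i j /eqP; rewrite (_ : (i *+ 3 == j *+ 3) = (i == j)) => [/eqP //|].
by move: i j => [[|[|[|[|[|a]]]]] lta] [[|[|[|[|[|b]]]]] ltb].
Qed.

Lemma pentagon_blowup_shift V red f (k : 'I_5) :
  pentagon_blowup V red f -> pentagon_blowup V red (fun x => f x - k).
Proof.
move=> /pentagon_blowupP[ex col]; apply/pentagon_blowupP; split=> [i|x y xV yV].
  by have [x xV fx] := ex (i + k); exists x => //; rewrite fx addrK.
have [c1 c2] := col x y xV yV.
by split=> e; [apply: c1|apply: c2]; apply: (addIr (- k)); rewrite e !(addrAC _ _ (- k)).
Qed.

Lemma sizesE u f : sizes u f = blob_sizes ([set: T] :\ u) f.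
Proof.
by apply: eq_map => i; apply: eq_card => x; rewrite !inE andbT.
Qed.

Lemma sizes_shift u f (k : 'I_5) : sizes u (fun x => f x - k) = rot k (sizes u f).
Proof.
rewrite /sizes -map_rot.
have -> : rot k (enum 'I_5) = [seq i + k | i <- enum 'I_5].
  apply: (inj_map val_inj); rewrite map_rot -[in RHS]map_comp val_enum_ord.
  rewrite (eq_map (g := (fun i => (i + k) %% 5)%N \o val)) // map_comp val_enum_ord.
  by case: k => [[|[|[|[|[|k]]]]] ltk].
rewrite -[RHS]map_comp; apply: eq_map => i; apply: eq_card => x /=.
by rewrite !inE subr_eq.
Qed.

(** * Putting the new vertex into a blob *)

Definition wrong red u f (i : 'I_5) : pred T := [pred w | (w != u) &&
  (((f w == i + 1) || (f w == i - 1)) && ~~ red u w ||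
   ((f w == i + 1 + 1) || (f w == i - 1 - 1)) && red u w)].

(** Grouped by blob: the two red neighbours of blob [i] contribute their non-links, the two blue
    ones their links, and blob [i] itself nothing. *)
Lemma card_wrong red u f (i : 'I_5) :
  #|wrong red u f i| = defect (sizes u f) (links u red f) i.
Proof.
rewrite -sum1_card (partition_big f predT) //=.
have [n1 n2 n3 n4 [n5 n6]] : [/\ (i - 1 == i + 1) = false, (i + 1 + 1 == i + 1) = false,
    (i + 1 + 1 == i - 1) = false, (i - 1 - 1 == i + 1) = false &
    (i - 1 - 1 == i - 1) = false /\ (i - 1 - 1 == i + 1 + 1) = false].
  by case: i => [[|[|[|[|[|i]]]]] lti].
pose w (j : 'I_5) := if (j == i + 1) || (j == i - 1) then (blob u f j - link red u f j)%N
  else if (j == i + 1 + 1) || (j == i - 1 - 1) then link red u f j else 0%N.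
rewrite (eq_bigr w) => [|j _].
  rewrite /defect -!(val_succ5, val_pred5) !nth_enum_map.
  rewrite (bigD1 (i - 1)) // (bigD1 (i + 1)) ?[i + 1 == _]eq_sym ?n1 //=.
  rewrite (bigD1 (i + 1 + 1)) ?n2 ?n3 //= (bigD1 (i - 1 - 1)) ?n4 ?n5 ?n6 //=.
  rewrite big1 => [|j /andP[/andP[/andP[j1 j2] j3] j4]]; last first.
    by rewrite /w (negbTE j1) (negbTE j2) (negbTE j3) (negbTE j4).
  by rewrite /w !eqxx !orbT n2 n3 n4 n5 /= addn0 !addnA.
rewrite sum1_card /w.
have wrongE : #|[pred x | wrong red u f i x && (f x == j)]| =
    #|[pred x | (x != u) && (f x == j) & ((j == i + 1) || (j == i - 1)) && ~~ red u x
      || ((j == i + 1 + 1) || (j == i - 1 - 1)) && red u x]|.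
  apply: eq_card => x; rewrite !inE /wrong /=.
  by have [/eqP ->|] := boolP (f x == j); rewrite ?andbF ?andbT.
rewrite [LHS]wrongE; case: ifP => [j1|j1].
  rewrite /blob -(cardID [pred x | red u x] [pred x | (x != u) && (f x == j)]).
  have -> : #|[predI [pred x | (x != u) && (f x == j)] & [pred x | red u x]]| = link red u f j.
    by apply: eq_card => x; rewrite !inE andbA.
  rewrite addKn; apply: eq_card => x; rewrite !inE /= andbC.
  suff -> : (j == i + 1 + 1) || (j == i - 1 - 1) = false by rewrite orbF.
  by apply: negbTE; case/orP: j1 => /eqP ->; rewrite eq_sym negb_or ?[_ == i - 1 - 1]eq_sym
    ?n2 ?n3 ?n4 ?n5.
case: ifP => j2; last by apply: eq_card0 => x; rewrite !inE /= andbF.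
by apply: eq_card => x; rewrite !inE /= andbA.
Qed.

Lemma extend_blowup red u f (i : 'I_5) : symmetric red ->
  pentagon_blowup ([set: T] :\ u) red f -> wrong red u f i =i pred0 ->
  pentagon_blowup [set: T] red (fun x => if x == u then i else f x).
Proof.
move=> red_sym /pentagon_blowupP[ex col] ok; apply/pentagon_blowupP; split=> [j|x y _ _].
  have [x] := ex j; rewrite !inE andbT => /negbTE xu fx.
  by exists x; rewrite ?xu.
have okP w : w != u -> (f w = i + 1 \/ f w = i - 1 -> red u w) /\
    (f w = i + 1 + 1 \/ f w = i - 1 - 1 -> ~~ red u w).
  move=> wu; have := ok w; rewrite !inE wu /= => /negbT; rewrite negb_or => /andP[h1 h2].
  by split=> fw; [move: h1|move: h2]; case: fw => ->; rewrite eqxx ?orbT /= ?negbK.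
have [n1 n2 _] := ord5_neq i.
have [/eqP xu|xu] := boolP (x == u); have [/eqP yu|yu] := boolP (y == u).
- by split=> /eqP; rewrite ?n1 ?n2.
- by have [h1 h2] := okP y yu; rewrite xu; split=> fy; [apply: h1|apply: h2]; left.
- have [h1 h2] := okP x xu; rewrite yu; split=> fy; rewrite red_sym; [apply: h1|apply: h2];
    by right; rewrite fy !addrK.
- by apply: col; rewrite !inE ?xu ?yu.
Qed.

Lemma blob_sizes_extend u f (i : 'I_5) :
  blob_sizes [set: T] (fun x => if x == u then i else f x) = incr_nth (sizes u f) i.
Proof.
apply: (@eq_from_nth _ 0%N) => [|j].
  by rewrite size_incr_nth !(size_map _ (enum 'I_5)) size_enum_ord ltn_ord.
rewrite (size_map _ (enum 'I_5)) size_enum_ord => ltj.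
rewrite nth_incr_nth -[j]/(val (Ordinal ltj)) [in RHS]nth_enum_map.
rewrite /blob_sizes (nth_enum_map (fun k => #|[set x in [set: T] | (if x == u then i else f x) == k]|)).
move: (Ordinal ltj) => k; rewrite (cardD1 u) !inE eqxx; congr (_ + _)%N.
by apply: eq_card => x; rewrite !inE; case: eqP.
Qed.

Lemma joins_structure red u f d L : symmetric red ->
  pentagon_blowup ([set: T] :\ u) red f -> joins (sizes u f) (links u red f) d L ->
  exists2 i : 'I_5, #|wrong red u f i| = d &
    exists2 t, t \in L & perm_eq (incr_nth (sizes u f) i) t.
Proof.
move=> red_sym blow /hasP[i]; rewrite mem_iota => lti /andP[/eqP def sL].
exists (Ordinal lti : 'I_5); first by rewrite card_wrong.
by exists (sort leq (incr_nth (sizes u f) i)); rewrite // perm_sym perm_sort.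
Qed.

Lemma joins0 red u f L : symmetric red ->
  pentagon_blowup ([set: T] :\ u) red f -> joins (sizes u f) (links u red f) 0 L ->
  exists g, pentagon_blowup [set: T] red g /\
    exists2 t, t \in L & perm_eq (blob_sizes [set: T] g) t.
Proof.
move=> red_sym blow /joins_structure[//|//|i /card0_eq ok tL].
exists (fun x => if x == u then i else f x); rewrite blob_sizes_extend; split=> //.
exact: extend_blowup.
Qed.

(** Exactly one vertex [v] has a wrongly coloured edge to [u], so flipping [u v] lets [u] join blob
    [i]. *)
Lemma joins1 red u f : symmetric red ->
  pentagon_blowup ([set: T] :\ u) red f -> joins (sizes u f) (links u red f) 1 B2 ->
  in_C2 [set: T] red.
Proof.
move=> red_sym blow /joins_structure[//|//|i ok tL].
have [v vP] := mem_card1 ok.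
have vu : v != u by have := vP v; rewrite !inE eqxx => /andP[].
exists u, v; split; rewrite ?inE // 1?eq_sym //.
exists (fun x => if x == u then i else f x); rewrite blob_sizes_extend; split=> //.
have off a b : a != u -> b != u -> flip red u v a b = red a b.
  by move=> /negbTE au /negbTE bu; rewrite /flip au bu andbF.
apply: extend_blowup; first exact: flip_sym.
  apply: eq_pentagon_blowup blow => x y; rewrite !inE !andbT => xu yu _.
  by rewrite off.
move=> w; have := vP w; rewrite !inE; have [/eqP ->|wu] := boolP (w == u); first by [].
rewrite /= /flip eqxx (negbTE wu) andbF orbF /=.
have [/eqP ->|_] := boolP (w == v); last by [].
have := vP v; rewrite !inE eqxx vu /= => h _.
have : ((f v == i + 1) || (f v == i - 1)) && ((f v == i + 1 + 1) || (f v == i - 1 - 1)) = false.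
  by move: (f v) i {ok tL vP h} => [[|[|[|[|[|a]]]]] lta] [[|[|[|[|[|b]]]]] ltb].
move: h; set P := (f v == i + 1) || _; set Q := (f v == i + 1 + 1) || _.
by case: P; case: Q; case: (red u v).
Qed.

Lemma eq_is_triangle V red red' S : (forall x y, red x y = red' x y) ->
  is_triangle V red S = is_triangle V red' S.
Proof.
move=> rr; rewrite /is_triangle; congr [&& _, _ & _].
by apply: eq_forallb => x; congr (_ ==> _); apply: eq_forallb => y; rewrite rr.
Qed.

Lemma eq_frac_tri_packing V red red' w : (forall x y, red x y = red' x y) ->
  frac_tri_packing V red w -> frac_tri_packing V red' w.
Proof.
move=> rr [w01 wl]; split=> [S|x y xV yV nxy].
  by rewrite -(eq_is_triangle _ _ rr); apply: w01.
rewrite -rr => /(wl x y xV yV nxy).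
by under eq_bigl do rewrite (eq_is_triangle _ _ rr).
Qed.

Lemma pack_gt_blue V red (c : rat) : pack_gt V (blue_rel red) c -> pack_gt V red c.
Proof.
have bbE x y : blue_rel (blue_rel red) x y = red x y by rewrite /blue_rel negbK.
case=> wR [wB [pR pB lt_c]]; exists wB, wR; split=> //.
  exact: eq_frac_tri_packing pB.
move: lt_c; rewrite addrC /tri_weight.
by under eq_bigl do rewrite (eq_is_triangle _ _ bbE).
Qed.

Lemma in_C2_blue V red : symmetric red -> in_C2 V (blue_rel red) -> in_C2 V red.
Proof.
move=> red_sym [x [y [xV yV nxy [f [blow [t tB ft]]]]]].
exists x, y; split=> //; exists (star f); split.
  apply: pentagon_blowup_star blow.
    by apply: flip_sym => a b; rewrite /blue_rel red_sym.
  by move=> a b; rewrite /flip /blue_rel; case: ifP; rewrite !negbK.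
exists t => //; apply: perm_trans ft.
exact: (blob_sizes_perm _ _ star_inj).
Qed.

Lemma pentagon_of_blowup u red f :
  pentagon_blowup ([set: T] :\ u) red f -> pentagon u red f.
Proof.
by move=> /pentagon_blowupP[_ col] x y xu yu; apply: col; rewrite !inE ?xu ?yu.
Qed.

Lemma blob_ge2 u f (L : seq (seq nat)) t : all (all (leq 2)) L -> t \in L ->
  perm_eq (sizes u f) t -> forall i, (1 < blob u f i)%N.
Proof.
move=> /allP L2 /L2/allP t2 ft i; apply: t2.
by rewrite -(perm_mem ft) map_f // mem_enum.
Qed.

Lemma links_le u red f : le_seq (links u red f) (sizes u f).
Proof.
move=> i; have [lti|gei] := ltnP i 5; last first.
  by rewrite !nth_default ?(size_map _ (enum 'I_5)) ?size_enum_ord.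
rewrite -[i]/(val (Ordinal lti)) !nth_enum_map.
by apply: subset_leq_card; apply/subsetP => x; rewrite !inE => /and3P[-> ->].
Qed.

(** * The two cases of the theorem *)

Definition goal_weight : rat := (#|T| * (#|T| - 1))%N%:R / 4%:R.

Lemma extend_C1 u red f t : symmetric red ->
  pentagon_blowup ([set: T] :\ u) red f -> t \in B1 -> perm_eq (sizes u f) t ->
  pack_gt [set: T] red goal_weight \/ in_C [set: T] red.
Proof.
move=> red_sym blow tB ft.
(* Only canonical size vectors were searched, so the blobs are first rotated into such an order. *)
have [k ltk can_k] : exists2 k, (k < 5)%N & canonical (rot k (sizes u f)).
  by apply: B1_canonical; exists t.
pose h x := f x - (Ordinal ltk).
have hE : sizes u h = rot k (sizes u f) by rewrite sizes_shift.
have {}blow : pentagon_blowup ([set: T] :\ u) red h by exact: pentagon_blowup_shift.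
have ht : perm_eq (sizes u h) t by rewrite hE perm_rot.
have [|/orP[j0|j1]|gain] := B1_cases tB ht _ (@links_le u red h).
- by rewrite hE.
- by have [g [blow_g tg]] := joins0 red_sym blow j0; right; left; exists g.
- by right; right; apply: joins1 j1.
left; apply: (pack_gt_gain1 (u := u) (f := h)) => //.
  exact: pentagon_of_blowup.
by apply: blob_ge2 tB ht.
Qed.

Lemma extend_C2_side u red f x y t : symmetric red -> x != u -> y != u ->
  pentagon_blowup ([set: T] :\ u) (flip red x y) f -> f y = f x + 1 ->
  t \in B2 -> perm_eq (sizes u f) t ->
  pack_gt [set: T] red goal_weight \/ in_C2 [set: T] red.
Proof.
move=> red_sym xu yu blow fy tB ft.
(* This rotation puts [x] into blob 0 and [y] into blob 1, the position assumed by [test2]. *)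
pose h z := f z - f x.
have hE : sizes u h = rot (f x) (sizes u f) by rewrite sizes_shift.
have {}blow : pentagon_blowup ([set: T] :\ u) (flip red x y) h by exact: pentagon_blowup_shift.
have ht : perm_eq (sizes u h) t by rewrite hE perm_rot.
have blob2 : forall i, (1 < blob u h i)%N by apply: blob_ge2 tB ht.
have hx : h x = 0 by rewrite /h subrr.
have hy : h y = 1 by rewrite /h fy addrAC subrr add0r.
have [|good|gain] := B2_cases _ tB ht (@links_le u (flip red x y) h).
- have -> a : entry (sides a) 0 = (entry a (val (0%R : 'I_5)) * entry a (val (1%R : 'I_5)))%num.
    by [].
  by rewrite !entry_toN !nth_enum_map; have := blob2 0; have := blob2 1; nia.
- right; have [g [blow_g tg]] := joins0 (flip_sym _ _ red_sym) blow good.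
  exists x, y; split; rewrite ?inE //; last by exists g.
  by apply/eqP => xy; move: hy; rewrite -xy hx.
by left; apply: (pack_gt_gain2 red_sym (pentagon_of_blowup blow)).
Qed.

(** The blobs of [x] and [y] are equal or differ by 1 or 2 up to sign. Difference 1 is the previous
    lemma, up to swapping [x] and [y]; difference 2 reduces to it by exchanging the colours. *)
Lemma extend_C2 u red f x y t : symmetric red -> x != u -> y != u ->
  pentagon_blowup ([set: T] :\ u) (flip red x y) f ->
  t \in B2 -> perm_eq (sizes u f) t ->
  pack_gt [set: T] red goal_weight \/ in_C [set: T] red.
Proof.
move=> red_sym xu yu blow tB ft.
have flipC a b : flip red x y a b = flip red y x a b.
  by rewrite /flip orbC.
have blow' : pentagon_blowup ([set: T] :\ u) (flip red y x) f.
  by apply: eq_pentagon_blowup blow => a b _ _ _.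
have blue_sym : symmetric (blue_rel red) by move=> a b; rewrite /blue_rel red_sym.
have blue_blow a b : pentagon_blowup ([set: T] :\ u) (flip red a b) f ->
    pentagon_blowup ([set: T] :\ u) (flip (blue_rel red) a b) (star f).
  apply: pentagon_blowup_star; first exact: flip_sym.
  by move=> c d; rewrite /flip /blue_rel; case: ifP.
have star_t : perm_eq (sizes u (star f)) t.
  by rewrite !sizesE in ft *; apply: perm_trans (blob_sizes_perm _ _ star_inj) ft.
have blue a b : a != u -> b != u -> pentagon_blowup ([set: T] :\ u) (flip red a b) f ->
    f b = f a + 1 + 1 -> pack_gt [set: T] red goal_weight \/ in_C [set: T] red.
  move=> au bu ab fb.
  have sb : star f b = star f a + 1 by apply/eqP; rewrite star_next fb.
  have [/pack_gt_blue|/in_C2_blue] := extend_C2_side blue_sym au bu (blue_blow _ _ ab) sb tB star_t.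
    by left.
  by right; right; auto.
(* A flip inside a blob leaves a blow-up with the same blobs, and [B2] is contained in [B1], so the
   first case applies. *)
have [/eqP fxy|] := boolP (f x == f y).
  apply: (extend_C1 (t := t) (f := f) (u := u)) => //.
    apply: eq_pentagon_blowup blow => a b _ _ nab; rewrite /flip.
    by case: ifP => // /orP[]/andP[/eqP ax /eqP bx]; rewrite ax bx fxy eqxx in nab.
  by move: t tB {ft star_t blue}; apply/allP.
have [/eqP|n1] := boolP (f y == f x + 1).
  by move=> fy; have [|] := extend_C2_side red_sym xu yu blow fy tB ft; [left|right; right].
have [/eqP|n2] := boolP (f x == f y + 1).
  by move=> fx; have [|] := extend_C2_side red_sym yu xu blow' fx tB ft; [left|right; right].
have [/eqP fy _|n3 n0] := boolP (f y == f x + 1 + 1); first exact: (blue x y).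
apply: (blue y x) => //; apply/eqP; move: n0 n1 n2 n3.
by move: (f x) (f y) => [[|[|[|[|[|a]]]]] lta] [[|[|[|[|[|b]]]]] ltb].
Qed.

End Structure.

Theorem theorem7p1 (T : finType) (red : rel T) (u : T) :
  symmetric red ->
  in_C ([set: T] :\ u) red ->
  pack_gt [set: T] red ((#|T| * (#|T| - 1))%N%:R / 4%:R)
  \/ in_C [set: T] red.
Proof.
move=> red_sym [[f [blow [t tB ft]]]|[x [y [xV yV nxy [f [blow [t tB ft]]]]]]].
  by apply: (extend_C1 red_sym blow tB); rewrite sizesE.
move: xV yV; rewrite !inE !andbT => xu yu.
by apply: (extend_C2 red_sym xu yu blow tB); rewrite sizesE.
Qed.
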